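(* Let $\alpha\ge-1/2$, $\nu\in\mathbb{R}$ and $\mu=-\nu$. Let $f:\mathbb{R}_+\to\mathbb{C}$ be vanishing at infinity and such that $t^\nu f(t)\in L^1(0,1)$. Assume that $$\int_M^\infty |df(t)|=o\big(M^{-\nu-1}\big)\ \text{ as }M\to\infty,\qquad\text{if }\nu<\alpha+1/2\text{ and }\nu>-1,$$ $$\int_M^\infty t^{\nu-\alpha-1/2}\,|df(t)|=o\big(M^{-\alpha-3/2}\big)\ \text{ as }M\to\infty,\qquad\text{if }\nu\ge\alpha+1/2\text{ or }\nu\le-1.$$ Then the convergence of the integral $\int_0^\infty t^\nu f(t)\,dt$ (i.e. $|\int_0^\infty t^\nu f(t)\,dt|<\infty$) is necessary and sufficient for the uniform convergence of $\mathcal{L}^{\alpha}_{\nu,\mu}f(r)$ on $\mathbb{R}_+$.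
   Context: $\mathbb{R}_+=[0,\infty)$. For $\alpha\ge-1/2$, $j_\alpha(z)=\Gamma(\alpha+1)(z/2)^{-\alpha}J_\alpha(z)$ is the normalized Bessel function, where $J_\alpha$ is the Bessel function of the first kind of order $\alpha$ (so $j_\alpha(0)=1$). Standing assumption: $f:\mathbb{R}_+\to\mathbb{C}$ is locally of bounded variation and locally integrable on $(0,\infty)$. Integrals against $|df(t)|$ are Stieltjes integrals with respect to the total variation of $f$. ''Vanishing at infinity'' means $f(t)\to0$ as $t\to\infty$. The integral $\int_0^\infty t^\nu f(t)\,dt$ is understood as $\lim_{N\to\infty}\int_0^N t^\nu f(t)\,dt$; it converges if this limit exists and is finite. The transform is $\mathcal{L}^{\alpha}_{\nu,\mu}f(r)=r^\mu\int_0^\infty (rt)^\nu f(t)j_\alpha(rt)\,dt$, where $r^\mu(rt)^\nu$ is read as $r^{\mu+\nu}t^\nu$ (so when $\mu+\nu=0$ the prefactor is $1$ for all $r\ge 0$, including $r=0$). It converges uniformly on a set $E\subset\mathbb{R}_+$ if the partial integrals $r^{\mu}\int_0^N (rt)^\nu f(t)j_\alpha(rt)\,dt$ converge uniformly in $r\in E$ as $N\to\infty$, equivalently $r^{\mu}\int_M^N (rt)^\nu f(t)j_\alpha(rt)\,dt\to0$ uniformly in $r\in E$ as $N>M\to\infty$. *)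

(* Defs.v *)
From HB Require Import structures.
From mathcomp Require Import all_boot all_order all_algebra.
From mathcomp Require Import all_classical all_reals all_analysis.
From mathcomp Require Import complex.
Set Implicit Arguments.
Unset Strict Implicit.
Unset Printing Implicit Defensive.
Import Order.TTheory GRing.Theory Num.Theory.
Import numFieldNormedType.Exports.
Local Open Scope classical_set_scope.
Local Open Scope ring_scope.
Local Open Scope complex_scope.

(* A function on [0, +oo[ is represented by a total function on R; only its
   values on [0, +oo[ are ever used. The topology and uniformity of the
   complex numbers are those of R[i]^o (the library puts none on R[i]). *)

Section bessel.
Context {R : realType}.
Implicit Types a x : R.

(* Euler's integral, meant for 0 < x. *)
Definition Gamma x : R :=
  \int[@lebesgue_measure R]_(t in `]0, +oo[) (t `^ (x - 1) * expR (- t)).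

Definition besselJ_coef a x : R^nat := fun k =>
  (-1) ^+ k / (k`!%:R * Gamma (k%:R + a + 1)) * (x / 2) `^ (2 * k%:R + a).

(* J_a(x), meant for 0 < x and -1 < a. *)
Definition besselJ a x : R := limn (series (besselJ_coef a x)).

(* The value at 0 is the continuous extension of the formula (where powR
   would give 0 `^ (- a) = 0 for a != 0). *)
Definition bessel_j a x : R :=
  if x == 0 then 1 else Gamma (a + 1) * (x / 2) `^ (- a) * besselJ a x.

End bessel.

Section complex_integral.
Context {R : realType}.
Implicit Types (D : set R) (f : R -> R[i]).

Definition cintegrable D f :=
  (@lebesgue_measure R).-integrable D (EFin \o (fun t => complex.Re (f t))) /\
  (@lebesgue_measure R).-integrable D (EFin \o (fun t => complex.Im (f t))).

Definition clocally_integrable D f :=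
  locally_integrable D (fun t => complex.Re (f t)) /\
  locally_integrable D (fun t => complex.Im (f t)).

Definition cintegral D f : R[i] :=
  (\int[@lebesgue_measure R]_(t in D) complex.Re (f t)) +i*
  (\int[@lebesgue_measure R]_(t in D) complex.Im (f t)).

End complex_integral.

Section complex_variation.
Context {R : realType}.
Implicit Types (a b : R) (f : R -> R[i]) (s : seq R).

(* Complex-valued versions of variation, variations, bounded_variation and
   total_variation, which the library has for real-valued functions only. *)
Definition cvariation a b f s : R :=
  let F := f \o nth b (a :: s) in
  \sum_(0 <= n < size s) ComplexField.Normc.normc (F n.+1 - F n).

Definition cvariations a b f : set R :=
  [set cvariation a b f s | s in itv_partition a b].

Definition cbounded_variation a b f := has_ubound (cvariations a b f).

Definition ctotal_variation a b f : \bar R :=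
  ereal_sup [set x%:E | x in cvariations a b f].

Definition locally_bounded_variation f :=
  forall a b, 0 < a -> a <= b -> cbounded_variation a b f.

End complex_variation.

Section stieltjes.
Context {R : realType}.
Implicit Types (a b M : R) (g V : R -> R) (f : R -> R[i]) (s : seq R).

(* A tagged partition of [a, b] is a partition s in the sense of
   itv_partition with a tag xi n in each [s_n, s_(n+1)]. *)
Definition tagging a b s (xi : nat -> R) :=
  forall n, (n < size s)%N ->
    nth b (a :: s) n <= xi n <= nth b (a :: s) n.+1.

Definition mesh_lt a b s (d : R) :=
  forall n, (n < size s)%N -> nth b (a :: s) n.+1 - nth b (a :: s) n < d.

Definition stieltjes_sum g V a b s (xi : nat -> R) : R :=
  \sum_(0 <= n < size s)
    g (xi n) * (V (nth b (a :: s) n.+1) - V (nth b (a :: s) n)).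

(* I is the Riemann-Stieltjes integral of g with respect to V on [a, b]. *)
Definition is_stieltjes g V a b (I : R) :=
  forall e : R, 0 < e -> exists2 d : R, 0 < d &
    forall s xi, itv_partition a b s -> mesh_lt a b s d -> tagging a b s xi ->
      `|stieltjes_sum g V a b s xi - I| < e.

(* I is the convergent improper integral of g(t) |df(t)| over [M, +oo[: the
   integrator is the variation function t |-> Var(f; [M, t]), which is finite
   when f is locally of bounded variation and 0 < M. *)
Definition is_variation_tail f g M (I : R) :=
  exists2 J : R -> R,
    forall N, M <= N ->
      is_stieltjes g (fun t => fine (ctotal_variation M t f)) M N (J N) &
    J N @[N --> +oo] --> I.

(* \int_M^oo g(t) |df(t)| = o(h(M)) as M -> +oo; in particular the integral
   converges for all large M. *)
Definition variation_tail_littleo f g (h : R -> R) :=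
  exists2 T : R -> R,
    (\forall M \near +oo, is_variation_tail f g M (T M)) &
    forall e : R, 0 < e -> \forall M \near +oo, `|T M| <= e * `|h M|.

End stieltjes.

Section transform.
Context {R : realType}.
Implicit Types (nu mu r N : R) (f : R -> R[i]).

Definition power_partial nu f N : R[i]^o :=
  cintegral `[0, N] (fun t => (t `^ nu)%:C * f t).

(* r^mu (r t)^nu is read as r^(mu + nu) t^nu; note that 0 `^ 0 = 1. *)
Definition transform_partial (alpha : R) nu mu f N r : R[i]^o :=
  (r `^ (mu + nu))%:C *
  cintegral `[0, N] (fun t => (t `^ nu)%:C * f t * (bessel_j alpha (r * t))%:C).

Definition transform_converges_uniformly (alpha : R) nu mu f (E : set R) :=
  exists L : R -> R[i]^o,
    {uniform E, transform_partial alpha nu mu f N @[N --> +oo] --> L}.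

End transform.

(* Main.v *)
(* Necessity is the case r = 0. For sufficiency, the tail condition gives
   t^(nu+1) f(t) -> 0 and the partial integrals over [M, N] are split at
   A = max(M, 1/r). On [M, A] the kernel j(rt) differs from 1 by O(rt), so the
   integral is within o(1) of the one for r = 0. On [A, N] one integrates by
   parts against |df|, using the primitive of t^nu j(rt), which is bounded by
   a multiple of the tail weight: this follows from the oscillation of
   u(x) = x^(a+1/2) j_a(x), a solution of u'' = (c/x^2 - 1) u whose energy
   u^2 + u'^2 stays bounded. The integration by parts is an Abel summation on
   Riemann-Stieltjes sums. *)
Require Import Defs.
From HB Require Import structures.
From mathcomp Require Import all_boot all_order all_algebra.
From mathcomp Require Import all_classical all_reals all_analysis.
From mathcomp Require Import complex measurable_realfun.
From mathcomp Require Import ring lra.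
Set Implicit Arguments.
Unset Strict Implicit.
Unset Printing Implicit Defensive.
Import Order.TTheory GRing.Theory Num.Theory.
Import numFieldNormedType.Exports.
Import ComplexField.Normc.
Local Open Scope classical_set_scope.
Local Open Scope ring_scope.

(** * Calculus and the Gamma function *)

Section calculus.
Context {R : realType}.
Implicit Types (f F : R -> R) (a b x y : R).
Notation mu := (@lebesgue_measure R).

(** Both tail conditions have one form: the integral of t^(nu+1-g) |df(t)| over [M, +oo[ is
    o(M^(-g)), with g = nu + 1 or g = alpha + 3/2. On [A, N] the primitive of t^nu j(rt) is at most
    K r^(-g) t^(nu+1-g), so the boundary terms and the Stieltjes integral together carry the factor
    r^(-g) A^(-g) = (rA)^(-g). It is at most 1 because rA >= 1 and g >= 0: this is the source of
    uniformity in r. The cut at 1/r has a price: how far N must go depends on r. Comparing two tails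
    with a common far end point removes this dependence. [f] may jump, and its variation is
    accessible only through Riemann-Stieltjes sums, hence the explicit partitions. When nu <= -1,
    the decay of t^(nu+1) f(t) comes from [f] vanishing at infinity. As the kernel is real, the
    estimates are made for Re f and Im f, whose increments are dominated by those of f. Gamma enters
    as Euler's integral; its recursion turns the coefficients of the series into Bessel's
    equation. *)

Lemma within_continuous_itv f a b :
  (forall x, a <= x <= b -> {for x, continuous f}) ->
  {within `[a, b], continuous f}.
Proof.
move=> cf; apply: continuous_in_subspaceT => x.
by rewrite inE/= in_itv/= => /cf.
Qed.

Lemma integrable_continuous f a b :
  (forall x, a <= x <= b -> {for x, continuous f}) ->
  mu.-integrable `[a, b] (EFin \o f).
Proof.
move=> cf; apply: continuous_compact_integrable; first exact: segment_compact.
exact: within_continuous_itv.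
Qed.

Lemma is_derive_continuous f x (l : R) : is_derive x 1 f l -> {for x, continuous f}.
Proof. by move=> [fd _]; apply/differentiable_continuous/derivable1_diffP. Qed.

Lemma Rintegral_derive f F a b : a <= b ->
  (forall x, a <= x <= b -> {for x, continuous f}) ->
  (forall x, a <= x <= b -> is_derive x 1 F (f x)) ->
  \int[mu]_(x in `[a, b]) f x = F b - F a.
Proof.
rewrite le_eqVlt => /predU1P[->|ab] cf dF.
  by rewrite set_itv1 Rintegral_set1 subrr.
rewrite /Rintegral (@continuous_FTC2 _ f F)//.
- exact: within_continuous_itv.
- split.
  + by move=> x /[!in_itv]/= /andP[/ltW ax /ltW xb]; have [] := dF x; rewrite ?ax.
  + apply: cvg_at_right_filter; apply: is_derive_continuous.
    by apply: dF; rewrite lexx ltW.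
  + apply: cvg_at_left_filter; apply: is_derive_continuous.
    by apply: dF; rewrite lexx ltW.
- move=> x /[!in_itv]/= /andP[/ltW ax /ltW xb].
  by rewrite derive1E; apply: derive_val; apply: dF; rewrite ax.
Qed.

Lemma continuous_powRl (p x : R) : 0 < x -> {for x, continuous (@powR R ^~ p)}.
Proof. by move=> x0; apply: is_derive_continuous; exact: is_derive1_powR. Qed.

End calculus.

(** * Euler's integral: finiteness, recursion, positivity *)

Section gamma.
Context {R : realType}.
Implicit Types (x t : R).
Notation mu := (@lebesgue_measure R).

Lemma Gamma_kernel_continuous x t : 0 < t ->
  {for t, continuous (fun t => t `^ x * expR (- t))}.
Proof.
move=> t0; apply: continuousM; first exact: continuous_powRl.
by apply: continuous_comp; [exact: opp_continuous|exact: continuous_expR].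
Qed.

Lemma Gamma_kernel_measurable x (D : set R) :
  measurable_fun D (fun t => t `^ x * expR (- t)).
Proof.
apply: measurable_funTS; apply: measurable_funM; first exact: measurable_powR.
by apply: measurableT_comp; [exact: measurable_expR|exact: oppr_measurable].
Qed.

Lemma Gamma_kernel_ge0 x t : 0 <= t `^ x * expR (- t).
Proof. by rewrite mulr_ge0// ?powR_ge0// expR_ge0. Qed.

(** With t = 2 x s, the inequality ln s <= s gives x ln t <= x ln (2 x) + t / 2. *)
Lemma powR_le_expR x t : 0 < x -> 0 < t ->
  t `^ x <= (2 * x) `^ x * expR (t / 2).
Proof.
move=> x0 t0.
rewrite /powR !gt_eqF ?mulr_gt0// -expRD ler_expR.
have tx0 : 0 < t / (2 * x) by rewrite divr_gt0// mulr_gt0.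
have -> : ln t = ln (2 * x) + ln (t / (2 * x)).
  by rewrite -lnM ?posrE ?mulr_gt0 ?invr_gt0 ?mulr_gt0//; congr (ln _); field; rewrite gt_eqF.
rewrite mulrDr lerD2l (le_trans (ler_wpM2l (ltW x0) (ltW (ln_sublinear tx0))))//.
by rewrite le_eqVlt; apply/orP; left; apply/eqP; field; rewrite gt_eqF.
Qed.

Lemma Gamma_kernel_continuous_itv x (a b : R) : 0 < a ->
  forall t, a <= t <= b -> {for t, continuous (fun t => t `^ x * expR (- t))}.
Proof.
by move=> a0 t /andP[at_ _]; apply: Gamma_kernel_continuous; exact: lt_le_trans at_.
Qed.

(** Half of e^(-t) absorbs the power of t; what remains is a multiple of the exponential density of
    rate 1/2, whose own factor 1/2 explains the 2 in the constant. *)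
Lemma Gamma_kernel_integrable_gt0 x : 0 < x ->
  mu.-integrable `]0, +oo[ (fun t => (t `^ x * expR (- t))%:E).
Proof.
move=> x0.
have r0 : (0 : R) < 2^-1 by [].
have : mu.-integrable `]0, +oo[ (EFin \o exponential_pdf (2^-1 : R)).
  by apply: integrableS (integrable_exponential_pdf r0).
move=> h.
have := @integrableZl _ _ _ mu _ (measurable_itv _) (2 * (2 * x) `^ x) _ h.
apply: le_integrable => //.
  by apply/measurable_EFinP; exact: Gamma_kernel_measurable.
move=> t /=; rewrite in_itv/= andbT => t0.
rewrite lee_fin !ger0_norm ?Gamma_kernel_ge0//; last first.
  by rewrite mulr_ge0 ?exponential_pdf_ge0// mulr_ge0// powR_ge0.
rewrite exponential_pdfE; last exact: ltW.
rewrite mulrACA mulfV// mul1r.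
have -> : expR (- t) = expR (- 2^-1 * t) * expR (- (t / 2)).
  by rewrite -expRD; congr expR; field.
rewrite mulrC -mulrA [leRHS]mulrC ler_pM2l ?expR_gt0// mulrC expRN.
by rewrite ler_pdivrMr ?expR_gt0// powR_le_expR.
Qed.

(** Compact exhaustion of ]0, +oo[ that avoids 0, where t^(x-1) is singular for x < 1. *)
Let S n : set R := `[n.+1%:R^-1, n.+1%:R].

Let bigcup_S : \bigcup_n S n = `]0, +oo[%classic.
Proof.
apply/seteqP; split=> [t [n _]|t] ; rewrite /S/= !in_itv/= ?andbT.
  by move=> /andP[nt _]; apply: (lt_le_trans _ nt); rewrite invr_gt0.
move=> t0; pose n := (Num.trunc t + Num.trunc t^-1)%N.
have tn : t <= n.+1%:R.
  apply: ltW; apply: lt_le_trans (truncnS_gt _) _.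
  by rewrite ler_nat ltnS leq_addr.
have tVn : t^-1 <= n.+1%:R.
  apply: ltW; apply: lt_le_trans (truncnS_gt _) _.
  by rewrite ler_nat ltnS leq_addl.
exists n => //; rewrite /S/= in_itv/= tn andbT.
by rewrite -[leRHS]invrK lef_pV2 ?posrE ?invr_gt0.
Qed.

Let S_mono : nondecreasing_seq S.
Proof.
move=> m n mn; apply/subsetPset => t; rewrite /S/= !in_itv/= => /andP[a b].
apply/andP; split.
  by apply: le_trans a; rewrite lef_pV2 ?posrE// ler_nat.
by rewrite (le_trans b)// ler_nat.
Qed.

Lemma Gamma_partial_cvg x :
  (\int[mu]_(t in S n) (t `^ x * expR (- t))%:E @[n --> \oo] -->
   \int[mu]_(t in `]0%R, +oo[) (t `^ x * expR (- t))%:E)%E.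
Proof.
rewrite -bigcup_S; apply: ge0_nondecreasing_set_cvg_integral => //.
- by move=> n; exact: measurable_itv.
- by move=> n; apply/measurable_EFinP; exact: Gamma_kernel_measurable.
- by move=> n t _; rewrite lee_fin Gamma_kernel_ge0.
Qed.

Let SVn0 n : (0 : R) < n.+1%:R^-1.
Proof. by rewrite invr_gt0. Qed.

Let SVn_le n : (n.+1%:R^-1 : R) <= n.+1%:R.
Proof. by rewrite (@le_trans _ _ 1)// ?invf_le1// ler1n. Qed.

(** Integration by parts, done by integrating the derivative of t^x e^(-t) over [S n]. *)
Lemma Gamma_partialS x n : 0 < x ->
  x * (\int[mu]_(t in S n) (t `^ (x - 1) * expR (- t))) =
  \int[mu]_(t in S n) (t `^ x * expR (- t)) +
  (n.+1%:R `^ x * expR (- n.+1%:R) - n.+1%:R^-1 `^ x * expR (- n.+1%:R^-1)).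
Proof.
move=> x0; pose F t := t `^ x * expR (- t).
pose f t := x * (t `^ (x - 1) * expR (- t)) - t `^ x * expR (- t).
have i1 p : mu.-integrable (S n) (fun t => (t `^ p * expR (- t))%:E).
  apply: (@integrable_continuous _ (fun t => t `^ p * expR (- t))).
  exact: Gamma_kernel_continuous_itv.
have <- : \int[mu]_(t in S n) f t = F n.+1%:R - F n.+1%:R^-1.
  apply: Rintegral_derive => // t /andP[nt _].
    have t0 := lt_le_trans (SVn0 n) nt.
    apply: continuousB; last exact: Gamma_kernel_continuous.
    by apply: continuousM; [exact: cst_continuous|exact: Gamma_kernel_continuous].
  have t0 := lt_le_trans (SVn0 n) nt.
  have := is_derive1_powR x t0; rewrite /F => d1.
  by apply: is_derive_eq; rewrite /f /GRing.scale/=; ring.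
rewrite RintegralB//; [|exact: measurable_itv| |exact: i1].
  by rewrite RintegralZl//; [ring|exact: measurable_itv|exact: i1].
exact: (@integrableZl _ _ _ mu _ (measurable_itv _) x _ (i1 _)).
Qed.

Lemma Gamma_boundary_cvg0 x : 0 < x ->
  (n.+1%:R `^ x * expR (- n.+1%:R) - n.+1%:R^-1 `^ x * expR (- n.+1%:R^-1) : R)
    @[n --> \oo] --> (0 : R).
Proof.
move=> x0; rewrite -[X in _ --> X](subr0 0); apply: cvgB.
- apply: (@squeeze_cvgr _ _ _ _ (fun=> 0)
    (fun n => (2 * x) `^ x * expR (- (n.+1%:R / 2)))); last 2 first.
  + exact: cvg_cst.
  + rewrite -[X in _ --> X](mulr0 ((2 * x) `^ x)); apply: cvgM; first exact: cvg_cst.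
    apply: (@cvg_comp _ _ _ (fun n => n.+1%:R / 2 : R) (fun t => expR (- t)) _ +oo);
      last exact: cvgr_expR.
    apply/cvgryPge => A; near=> n; rewrite ler_pdivlMr//.
    have An : A * 2 <= n%:R by near: n; exact: nbhs_infty_ger.
    by apply: (le_trans An); rewrite ler_nat.
  apply: nearW => n; rewrite Gamma_kernel_ge0/=.
  have -> : expR (- n.+1%:R) = expR (- (n.+1%:R / 2)) * expR (- (n.+1%:R / 2)) :> R.
    by rewrite -expRD; congr (expR _); field.
  rewrite mulrA ler_pM2r ?expR_gt0// expRN ler_pdivrMr ?expR_gt0//.
  exact: powR_le_expR.
- apply: (@squeeze_cvgr _ _ _ _ (fun=> 0) (fun n => n.+1%:R^-1 `^ x)); last 2 first.
  + exact: cvg_cst.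
  + move/cvg_at_rightP : (powR_cvg0 x0); apply; split; first by move=> n.
    exact: cvg_harmonic.
  apply: nearW => n; rewrite Gamma_kernel_ge0/= ler_piMr ?powR_ge0//.
Unshelve. all: by end_near. Qed.

(** Monotone convergence along [S n] in the integrated recursion. Stated in the extended reals, it
    also yields finiteness of Euler's integral for 0 < x <= 1, which the domination by the
    exponential density does not reach. *)
Lemma Gamma_integral x : 0 < x ->
  (\int[mu]_(t in `]0%R, +oo[) (t `^ (x - 1) * expR (- t))%:E =
   (Gamma (x + 1) / x)%:E)%E.
Proof.
move=> x0; rewrite -(cvg_lim (@ereal_hausdorff R) (@Gamma_partial_cvg (x - 1))).
apply: cvg_lim; first exact: ereal_hausdorff.
pose A n := \int[mu]_(t in S n) (t `^ (x - 1) * expR (- t)).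
pose B n := \int[mu]_(t in S n) (t `^ x * expR (- t)).
have iS p n : mu.-integrable (S n) (fun t => (t `^ p * expR (- t))%:E).
  apply: (@integrable_continuous _ (fun t => t `^ p * expR (- t))).
  exact: Gamma_kernel_continuous_itv.
have cB : B n @[n --> \oo] --> Gamma (x + 1).
  have := @Gamma_partial_cvg x; rewrite /Gamma addrK /Rintegral.
  set I := (X in (_ --> X)%E -> _) => cI.
  apply: fine_cvg; rewrite fineK//.
  by apply: integrable_fin_num => //; exact: Gamma_kernel_integrable_gt0.
have cA : A n @[n --> \oo] --> Gamma (x + 1) / x.
  have -> : A = fun n => (B n + (n.+1%:R `^ x * expR (- n.+1%:R) -
      n.+1%:R^-1 `^ x * expR (- n.+1%:R^-1))) / x.
    by apply/funext => n; rewrite -Gamma_partialS// mulrAC divff ?mul1r// gt_eqF.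
  apply: cvgM; last exact: cvg_cst.
  by rewrite -[X in _ --> X]addr0; apply: cvgD => //; exact: Gamma_boundary_cvg0.
suff -> : (fun n => \int[mu]_(t in S n) (t `^ (x - 1) * expR (- t))%:E)%E =
    (fun n => (A n)%:E) by apply: cvg_EFin => //; exact: nearW.
apply/funext => n; rewrite /A /Rintegral fineK//.
by apply: integrable_fin_num; [exact: measurable_itv|exact: iS].
Qed.

Lemma GammaS x : 0 < x -> Gamma (x + 1) = x * Gamma x.
Proof.
move=> x0; rewrite [in RHS]/Gamma /Rintegral Gamma_integral//=.
by rewrite mulrC divfK// gt_eqF.
Qed.

Lemma Gamma_gt0 x : 0 < x -> 0 < Gamma x.
Proof.
move=> x0.
(* Lower bound of the kernel on [1, 2], an interval of length 1; the minimum covers both signs of x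
   - 1. *)
have c0 : 0 < Num.min 1 (2 `^ (x - 1)) * expR (- 2) :> R.
  by rewrite mulr_gt0 ?expR_gt0// lt_min ltr01 powR_gt0.
apply: (lt_le_trans c0).
have m12 : measurable (`[1, 2] : set R) by exact: measurable_itv.
have i12 : mu.-integrable `[1, 2] (fun t => (t `^ (x - 1) * expR (- t))%:E).
  apply: (@integrable_continuous _ (fun t => t `^ (x - 1) * expR (- t))).
  exact: Gamma_kernel_continuous_itv.
apply: (@le_trans _ _ (\int[mu]_(t in `[1, 2]) (t `^ (x - 1) * expR (- t)))).
  have m1 : fine (mu `[1%R, 2%R]) = 1.
    by rewrite lebesgue_measure_itv/= lte_fin ltr1n -EFinD/=; ring.
  rewrite -[leLHS]mulr1 -[X in _ * X]m1.
  rewrite -Rintegral_cst//; apply: le_Rintegral => //.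
    apply: (@integrable_continuous _ (cst _)) => t _; exact: cst_continuous.
  move=> t /=; rewrite in_itv/= => /andP[t1 t2].
  have t0 : 0 < t by rewrite (lt_le_trans ltr01).
  apply: ler_pM; [by rewrite le_min ler01 powR_ge0|exact: expR_ge0| |
    by rewrite ler_expR lerN2].
  rewrite ge_min; have [x1|x1] := leP 1 x.
    by apply/orP; left; rewrite -[leLHS](powRr0 t) ler_powR// subr_ge0.
  apply/orP; right.
  have -> : x - 1 = - (1 - x) by ring.
  rewrite !powRN lef_pV2 ?posrE ?powR_gt0//.
  by apply: ge0_ler_powR; rewrite ?nnegrE ?subr_ge0 ?(ltW x1) ?(ltW t0).
rewrite /Gamma /Rintegral fine_le//.
- exact: integrable_fin_num.
- by rewrite Gamma_integral.
- apply: ge0_subset_integral => //.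
  + by apply/measurable_EFinP; exact: Gamma_kernel_measurable.
  + by move=> t _; rewrite lee_fin Gamma_kernel_ge0.
  + move=> t /=; rewrite !in_itv/= andbT => /andP[t1 _].
    by rewrite (lt_le_trans ltr01).
Qed.

End gamma.

(** * The power series of the Bessel function *)

Section monotone.
Context {R : realType}.
Implicit Types (f g F G : R -> R) (a b x : R).

Lemma is_derive_le F G f g a b : a <= b ->
  (forall x, a <= x <= b -> is_derive x 1 F (f x)) ->
  (forall x, a <= x <= b -> is_derive x 1 G (g x)) ->
  (forall x, a <= x <= b -> f x <= g x) ->
  F b - F a <= G b - G a.
Proof.
rewrite le_eqVlt => /predU1P[->|ab] dF dG fg; first by rewrite !subrr.
have dGF x : a <= x <= b -> is_derive x 1 (G \- F) (g x - f x).
  by move=> xab; have := dF x xab; have := dG x xab => *; apply: is_deriveB.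
have dGFo x : x \in `]a, b[ -> is_derive x 1 (G \- F) (g x - f x).
  by move=> /[!in_itv]/= /andP[/ltW ax /ltW xb]; apply: dGF; rewrite ax.
have cGF : {within `[a, b], continuous (G \- F)}.
  by apply: within_continuous_itv => x /dGF; exact: is_derive_continuous.
have [c cab E] := MVT ab dGFo cGF.
rewrite -subr_ge0 (_ : _ - _ = (G \- F) b - (G \- F) a); last by rewrite /=; ring.
rewrite E mulr_ge0 ?subr_ge0 ?(ltW ab)// fg//.
by move: cab; rewrite in_itv/= => /andP[/ltW-> /ltW->].
Qed.

Lemma is_derive_norm_le F G f g a b : a <= b ->
  (forall x, a <= x <= b -> is_derive x 1 F (f x)) ->
  (forall x, a <= x <= b -> is_derive x 1 G (g x)) ->
  (forall x, a <= x <= b -> `|f x| <= g x) ->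
  `|F b - F a| <= G b - G a.
Proof.
move=> ab dF dG fg; rewrite ler_norml; apply/andP; split; last first.
  apply: (@is_derive_le _ _ f g) => // x /fg; exact/le_trans/ler_norm.
have dN x : a <= x <= b -> is_derive x 1 (\- G) (- g x).
  by move=> /dG ?; apply: is_deriveN.
have -> : - (G b - G a) = (\- G) b - (\- G) a by rewrite /= opprB addrC opprK.
apply: (@is_derive_le _ _ (\- g) f) => // x /fg; by rewrite ler_norml => /andP[].
Qed.

Lemma continuous_itv_bounded f a b :
  (forall x, a <= x <= b -> {for x, continuous f}) ->
  exists2 C, 0 < C & forall x, a <= x <= b -> `|f x| <= C.
Proof.
move=> cf.
have [ab|ba] := leP a b; last first.
  exists 1 => // x /andP[ax xb].
  by have := le_lt_trans (le_trans ax xb) ba; rewrite ltxx.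
have [|c cab Hc] := @EVT_max R (fun x => `|f x|) a b ab.
  apply: within_continuous_itv => x /cf cfx.
  by apply: continuous_comp => //; exact: norm_continuous.
exists (`|f c| + 1) => [|x xab]; first by rewrite ltr_wpDl.
by rewrite (le_trans (Hc x _)) ?lerDl// in_itv.
Qed.

End monotone.

Section bessel_series.
Context {R : realType}.
Variable a : R.
Hypothesis a_ge : - (1 / 2) <= a.

(** Coefficients of j_a as an entire series in z = x^2 / 4, the variable in which the fractional
    powers have cancelled. *)
Definition bessel_coef (k : nat) : R :=
  (-1) ^+ k * Gamma (a + 1) / (k`!%:R * Gamma (k%:R + a + 1)).

Let ka_gt0 (k : nat) : 0 < k%:R + a + 1.
Proof.
have k0 : (0 : R) <= k%:R by [].
by move: a_ge => ?; lra.
Qed.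

Lemma bessel_coef0 : bessel_coef 0 = 1.
Proof.
rewrite /bessel_coef expr0 fact0 add0r !mul1r divff// gt_eqF// Gamma_gt0//.
by have := ka_gt0 0; rewrite add0r.
Qed.

Lemma bessel_coefS k :
  (k%:R + a + 1) * (k.+1%:R * bessel_coef k.+1) = - bessel_coef k.
Proof.
have G0 : 0 < Gamma (k%:R + a + 1) by exact: Gamma_gt0.
rewrite /bessel_coef factS natrM exprS.
have -> : k.+1%:R + a + 1 = (k%:R + a + 1) + 1 by rewrite -natr1; ring.
rewrite (GammaS (ka_gt0 k)); field.
by rewrite !gt_eqF// ltr0n fact_gt0.
Qed.

(** The n-th derivative in z of that series. *)
Definition bessel_p n (z : R) : R := limn (pseries (iter n (@pseries_diffs R) bessel_coef) z).

(** The factor 2 is the inverse of k + a + 1 >= 1/2. *)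
Lemma bessel_coef_bound k : `|bessel_coef k.+1| * k.+1%:R <= 2 * `|bessel_coef k|.
Proof.
have -> : `|bessel_coef k| = (k%:R + a + 1) * (k.+1%:R * `|bessel_coef k.+1|).
  rewrite -normrN -bessel_coefS normrM (ger0_norm (ltW (ka_gt0 k))); congr (_ * _).
  by rewrite normrM ger0_norm.
rewrite [leLHS]mulrC mulrA.
rewrite -[leLHS]mul1r ler_wpM2r ?mulr_ge0//.
have k0 : (0 : R) <= k%:R by [].
by move: a_ge => ?; lra.
Qed.

(** The right-hand side is the k-th coefficient of the n-th derivative of e^(2z), so every formal
    derivative converges on the whole line. *)
Lemma iter_diffs_bound n k :
  `|iter n (@pseries_diffs R) bessel_coef k| <= 2 ^+ n * 2 ^+ k / k`!%:R.
Proof.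
have fS i (x y : R) : x / i`!%:R * y = i.+1%:R * (x * y) / (i.+1)`!%:R.
  by rewrite factS natrM; field; rewrite !gt_eqF ?ltr0n ?fact_gt0 ?ltr0Sn.
elim: n k => [|n IH] k.
  rewrite expr0 mul1r; elim: k => [|k IH]/=.
    by rewrite expr0 fact0 bessel_coef0 divr1 normr1.
  rewrite -(@ler_pM2r _ k.+1%:R)// (le_trans (bessel_coef_bound k))//.
  rewrite mulrC (le_trans (ler_wpM2r _ IH))// fS exprSr.
  by rewrite le_eqVlt; apply/orP; left; apply/eqP; ring.
rewrite iterS /pseries_diffs normrM ger0_norm//.
rewrite (le_trans (ler_wpM2l _ (IH _)))// le_eqVlt; apply/orP; left; apply/eqP.
rewrite factS natrM !exprS; field.
by rewrite !gt_eqF ?ltr0n ?fact_gt0 ?ltr0Sn.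
Qed.

Lemma is_cvg_bessel_pseries n z :
  cvgn (pseries (iter n (@pseries_diffs R) bessel_coef) z).
Proof.
apply: normed_cvg; apply: (@series_le_cvg _ _
  (2 ^+ n *: exp_coeff (2 * `|z|))) => /=.
- by move=> k.
- by move=> k; rewrite mulr_ge0// exp_coeff_ge0// mulr_ge0.
- move=> k; rewrite normrM (le_trans (ler_wpM2r _ (iter_diffs_bound n k)))//.
  rewrite /exp_coeff/= /GRing.scale/= exprMn normrX.
  by rewrite le_eqVlt; apply/orP; left; apply/eqP; rewrite -[_ *: _]/(_ * _); ring.
- exact/is_cvg_seriesZ/is_cvg_series_exp_coeff.
Qed.

Lemma is_derive_bessel_p n (z : R) : is_derive z (1 : R) (bessel_p n) (bessel_p n.+1 z).
Proof.
apply: (@pseries_snd_diffs _ (iter n (@pseries_diffs R) bessel_coef) (`|z| + 1)).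
- exact: is_cvg_bessel_pseries.
- exact: (@is_cvg_bessel_pseries n.+1).
- exact: (@is_cvg_bessel_pseries n.+2).
- by rewrite [ltRHS]ger0_norm ?ltrDl.
Qed.

(** By [bessel_coefS] the terms of equal degree cancel, so the partial sums of the left-hand side
    already vanish. *)
Lemma bessel_ode z : z * bessel_p 2 z + (a + 1) * bessel_p 1 z + bessel_p 0 z = 0.
Proof.
have c2 := @pseries_diffs_equiv _ _ _ (@is_cvg_bessel_pseries 2 z).
have c1 := @is_cvg_bessel_pseries 1 z.
have c0 := @is_cvg_bessel_pseries 0 z.
pose b := bessel_coef.
have h : (z * series (fun i => i%:R * pseries_diffs b i * z ^+ i.-1) n +
    (a + 1) * pseries (pseries_diffs b) z n + pseries b z n) @[n --> \oo] -->
    z * bessel_p 2 z + (a + 1) * bessel_p 1 z + bessel_p 0 z.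
  by apply: cvgD c0; apply: cvgD; apply: cvgM => //; exact: cvg_cst.
rewrite -(cvg_lim (@Rhausdorff R) h).
apply: lim_near_cst => //; apply: nearW => n.
rewrite /pseries /series/= !mulr_sumr -!big_split/= big1// => i _.
rewrite /pseries_diffs /b.
suff -> : bessel_coef i = - ((i%:R + a + 1) * (i.+1%:R * bessel_coef i.+1)).
  case: i => [|i] /=; first by rewrite !expr0 add0r; ring.
  by rewrite exprS; ring.
by rewrite bessel_coefS opprK.
Qed.

Lemma bessel_p0 : bessel_p 0 0 = 1.
Proof.
apply: lim_near_cst => //; near=> n.
rewrite /pseries /series/= -[n]prednK; last by near: n; exact: nbhs_infty_gt.
rewrite big_nat_recl//= expr0 mulr1 bessel_coef0 big1 ?addr0// => i _.
by rewrite exprS mul0r mulr0.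
Unshelve. all: by end_near. Qed.

Lemma bessel_jE x : 0 <= x -> bessel_j a x = bessel_p 0 (x ^+ 2 / 4).
Proof.
rewrite le_eqVlt => /predU1P[<-|x0].
  by rewrite /bessel_j eqxx expr0n/= mul0r bessel_p0.
have G0 : 0 < Gamma (a + 1) by apply: Gamma_gt0; have := ka_gt0 0; rewrite add0r.
have h0 : 0 < (x / 2) `^ a by rewrite powR_gt0// divr_gt0.
rewrite /bessel_j gt_eqF// /besselJ.
have -> : besselJ_coef a x = ((x / 2) `^ a / Gamma (a + 1)) *:
    (fun k => bessel_coef k * (x ^+ 2 / 4) ^+ k).
  apply/funext => k; rewrite /besselJ_coef /bessel_coef /GRing.scale/=.
  rewrite powRD; last by apply/implyP => _; rewrite gt_eqF// divr_gt0.
  rewrite -natrM powR_mulrn ?divr_ge0 ?ltW// exprM.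
  have -> : (x / 2) ^+ 2 = x ^+ 2 / 4 by field.
  have Gk := Gamma_gt0 (ka_gt0 k).
  by rewrite -[_ *: _]/(_ * _); field; rewrite !gt_eqF ?ltr0n ?fact_gt0.
rewrite lim_seriesZ; last exact: (@is_cvg_bessel_pseries 0).
rewrite powRN /GRing.scale/= /bessel_p /pseries.
by field; rewrite ?gt_eqF.
Qed.

End bessel_series.

(** * Growth of the Bessel kernel and of its primitive *)

Section bessel_asymptotics.
Context {R : realType}.
Variable a : R.
Hypothesis a_ge : - (1 / 2) <= a.
Implicit Types x y t nu : R.

Let dp n (z : R) := is_derive_bessel_p a_ge n z.

(** Even extension of j_a to the whole line; unlike [bessel_j] it is visibly differentiable
    everywhere, in particular at 0. *)
Definition bessel_e x := bessel_p a 0 (x ^+ 2 / 4).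

Definition bessel_e' x := bessel_p a 1 (x ^+ 2 / 4) * (x / 2).

Lemma is_derive_invr x : 0 < x -> is_derive x (1 : R) (fun y : R => y^-1) (- x ^- 2).
Proof.
move=> x0; have x0' : x != 0 by rewrite gt_eqF.
have := @is_deriveV R id x 1 1 x0' (is_derive_id _ _).
by rewrite /GRing.scale/= mulr1.
Qed.

Lemma is_derive_sqr_quarter x : is_derive x (1 : R) (fun x => x ^+ 2 / 4) (x / 2).
Proof. by apply: is_derive_eq; rewrite /GRing.scale/=; field. Qed.

Lemma is_derive_bessel_e x : is_derive x (1 : R) bessel_e (bessel_e' x).
Proof.
have h := is_derive_sqr_quarter x.
have := @is_derive1_comp _ (bessel_p a 0) (fun x => x ^+ 2 / 4) x _ _ (dp 0 _) h.
exact.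
Qed.

(** Bessel's equation y'' + (2a+1)/x y' + y = 0, which is [bessel_ode] at z = x^2 / 4. *)
Lemma is_derive_bessel_e' x : 0 < x -> is_derive x (1 : R) bessel_e'
  (- bessel_e x - (2 * a + 1) / x * bessel_e' x).
Proof.
move=> x0.
have h := is_derive_sqr_quarter x.
have h1 := @is_derive1_comp _ (bessel_p a 1) (fun x => x ^+ 2 / 4) x _ _ (dp 1 _) h.
apply: is_derive_eq; rewrite /GRing.scale/= /bessel_e /bessel_e'.
have := bessel_ode a_ge (x ^+ 2 / 4).
set p0 := bessel_p a 0 _; set p1 := bessel_p a 1 _; set p2 := bessel_p a 2 _.
move=> /eqP; rewrite addr_eq0 => /eqP E; rewrite -[p0]opprK -E.
by field; rewrite gt_eqF.
Qed.

(* The Liouville substitution: [bessel_u] solves [u'' = (c / x^2 - 1) u]. *)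
Definition bessel_u x := x `^ (a + 1 / 2) * bessel_e x.

Definition bessel_u' x :=
  x `^ (a + 1 / 2) * ((a + 1 / 2) / x * bessel_e x + bessel_e' x).

Let c : R := a ^+ 2 - 1 / 4.

Lemma powR_pred x (p : R) : 0 < x -> x `^ (p - 1) = x `^ p / x.
Proof.
by move=> x0; rewrite powRB ?powRr1 ?ltW//; apply/implyP => _; rewrite gt_eqF.
Qed.

Lemma is_derive_bessel_u x : 0 < x -> is_derive x (1 : R) bessel_u (bessel_u' x).
Proof.
move=> x0; have h := is_derive1_powR (a + 1 / 2) x0.
have he := is_derive_bessel_e x.
apply: is_derive_eq; rewrite /bessel_u' powR_pred// /GRing.scale/=.
by field; rewrite gt_eqF.
Qed.

Lemma is_derive_bessel_u' x : 0 < x ->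
  is_derive x (1 : R) bessel_u' ((c / x ^+ 2 - 1) * bessel_u x).
Proof.
move=> x0; have h := is_derive1_powR (a + 1 / 2) x0.
have he := is_derive_bessel_e x.
have he' := is_derive_bessel_e' x0.
have hV : is_derive x (1 : R) (fun y : R => y^-1) (- x ^- 2).
  exact: is_derive_invr.
apply: is_derive_eq; rewrite /bessel_u /c powR_pred// /GRing.scale/=.
by field; rewrite gt_eqF.
Qed.

(** The energy E = u^2 + u'^2 satisfies E' = 2 c u u' / x^2 <= k E / x^2 with k = |c|. As 1/x^2 is
    integrable at infinity, the factor e^(k/x) compensates the growth: e^(k/x) E is nonincreasing on
    [1, +oo[. *)
Lemma bessel_u_bounded : exists2 C, 0 < C &
  forall x, 1 <= x -> `|bessel_u x| <= C /\ `|bessel_u' x| <= C.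
Proof.
pose E x := bessel_u x ^+ 2 + bessel_u' x ^+ 2.
pose k : R := `|c|.
pose F x := expR (k / x) * E x.
have k0 : 0 <= k by exact: normr_ge0.
have Fle x : 1 <= x -> F x <= F 1.
  move=> x1; rewrite -subr_le0.
  apply: (@le_trans _ _ (cst (0 : R) x - cst (0 : R) 1)); last by rewrite /= subrr.
  pose dF t := expR (k / t) * (- k / t ^+ 2) * E t +
    expR (k / t) * (2 * c / t ^+ 2 * bessel_u t * bessel_u' t).
  apply: (@is_derive_le _ F (cst 0) dF (cst 0)) => // t /andP[t1 _].
    have t0 : 0 < t by exact: lt_le_trans t1.
    have hu := is_derive_bessel_u t0.
    have hu' := is_derive_bessel_u' t0.
    have hV : is_derive t (1 : R) (fun y : R => y^-1) (- t ^- 2).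
      exact: is_derive_invr.
    have hk : is_derive t (1 : R) (fun y : R => k / y) (- k / t ^+ 2).
      by apply: is_derive_eq; rewrite /GRing.scale/=; field; rewrite gt_eqF.
    have he := @is_derive1_comp _ expR _ t _ _ (is_derive_expR _) hk.
    apply: is_derive_eq; rewrite /dF /E /GRing.scale/=.
    by field; rewrite gt_eqF.
  have t0 : 0 < t by exact: lt_le_trans t1.
  rewrite /dF -mulrA -mulrDr pmulr_rle0 ?expR_gt0//.
  rewrite (_ : _ + _ = (2 * c * bessel_u t * bessel_u' t - k * E t) / t ^+ 2);
    last by field; rewrite gt_eqF.
  rewrite pmulr_lle0 ?invr_gt0 ?exprn_gt0// subr_le0 /E.
  have ck : c <= k by exact: ler_norm.
  have ckN : - c <= k by rewrite /k -normrN; exact: ler_norm.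
  set p := bessel_u t; set q := bessel_u' t.
  (* Squares with weights k - c and k + c, both non-negative since k = |c|. *)
  have -> : k * (p ^+ 2 + q ^+ 2) = 2 * c * p * q +
      ((k - c) * (p + q) ^+ 2 + (k + c) * (p - q) ^+ 2) / 2 by field.
  rewrite lerDl divr_ge0// addr_ge0// mulr_ge0 ?sqr_ge0//; first by rewrite subr_ge0.
  by rewrite -lerBlDr sub0r.
exists (expR k * E 1 + 1) => [|x x1].
  rewrite ltr_wpDl// mulr_ge0 ?expR_ge0// addr_ge0 ?sqr_ge0//.
have EB : E x <= expR k * E 1.
  have := Fle x x1; rewrite /F divr1; apply: le_trans.
  rewrite ler_peMl ?addr_ge0 ?sqr_ge0//.
  by rewrite -expR0 ler_expR divr_ge0// (le_trans _ x1).
have B0 : 0 <= expR k * E 1 by rewrite (le_trans _ EB)// addr_ge0 ?sqr_ge0.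
(* From v^2 <= B follows |v| <= B + 1, which avoids a square root and keeps the constant
   positive. *)
have sq (v : R) : v ^+ 2 <= E x -> `|v| <= expR k * E 1 + 1.
  move=> vE; rewrite -(@ler_pXn2r _ 2) ?nnegrE ?addr_ge0// real_normK ?num_real//.
  by rewrite (le_trans vE)// (le_trans EB)//; nra.
by split; apply: sq; rewrite /E ?lerDl ?lerDr sqr_ge0.
Qed.

Lemma nonincreasing_powR (p x y : R) : p <= 0 -> 0 < x -> x <= y -> y `^ p <= x `^ p.
Proof.
move=> p0 x0 xy; have y0 := lt_le_trans x0 xy.
rewrite -[p]opprK !(powRN _ (- p)) lef_pV2 ?posrE ?powR_gt0//.
by apply: ge0_ler_powR; rewrite ?nnegrE ?oppr_ge0 ?(ltW x0) ?(ltW y0).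
Qed.

Lemma powR_le_max (p x t y : R) : 0 < x -> x <= t <= y ->
  t `^ p <= Num.max (x `^ p) (y `^ p).
Proof.
move=> x0 /andP[xt ty]; have t0 := lt_le_trans x0 xt.
rewrite le_max; have [p0|/ltW p0] := leP p 0.
  by rewrite nonincreasing_powR.
apply/orP; right; apply: ge0_ler_powR; rewrite ?nnegrE ?(ltW t0)//.
by rewrite (le_trans (ltW t0)).
Qed.

Lemma bessel_kernelE nu x : 0 < x ->
  x `^ nu * bessel_e x = x `^ (nu - a - 1 / 2) * bessel_u x.
Proof.
move=> x0; rewrite /bessel_u mulrA -powRD; last first.
  by apply/implyP => _; rewrite gt_eqF.
by congr (_ `^ _ * _); ring.
Qed.

Lemma bessel_kernel_continuous nu x : 0 < x ->
  {for x, continuous (fun x => x `^ nu * bessel_e x)}.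
Proof.
move=> x0; apply: continuousM; first exact: continuous_powRl.
exact/is_derive_continuous/is_derive_bessel_e.
Qed.

(** The kernel is t^b u(t) with b = nu - a - 1/2. Replacing u by c u / t^2 - u'' and integrating by
    parts twice gives an explicit main term [H] of size t^b and a remainder with integrand k t^(b-2)
    u, where the gain 1/t^2 makes the integral converge against the maximum of t^b. *)
Lemma bessel_kernel_antiderivative nu : exists P K, [/\ 0 <= K,
  forall x, 1 <= x -> is_derive x (1 : R) P (x `^ nu * bessel_e x) &
  forall x y, 1 <= x -> x <= y -> `|P y - P x| <=
    K * Num.max (x `^ (nu - a - 1 / 2)) (y `^ (nu - a - 1 / 2))].
Proof.
pose f x : R := x `^ nu * bessel_e x.
(* The lower limit is positive, where the kernel is continuous, and below 1, so that x = 1 is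
   interior for the fundamental theorem. *)
pose P x : R := \int[@lebesgue_measure R]_(t in `[2^-1, x]) f t.
have dP x : 1 <= x -> is_derive x (1 : R) P (f x).
  move=> x1; have x0 : 0 < x by exact: lt_le_trans x1.
  have [||||dPx PE] := @continuous_FTC1_closed R f 2^-1 x (x + 1).
  - by rewrite ltrDl.
  - apply: integrable_continuous => t /andP[t2 _]; apply: bessel_kernel_continuous.
    by apply: lt_le_trans t2.
  - by rewrite (lt_le_trans _ x1)// invf_lt1// ltr1n.
  - exact: bessel_kernel_continuous.
  by apply: DeriveDef => //; rewrite -derive1E.
set b := nu - a - 1 / 2; have [C C0 uC] := bessel_u_bounded.
pose k := b * (b - 1) - c.
exists P, (2 * (C * (`|b| + 1)) + `|k| * C); split => //.
  by rewrite addr_ge0 ?mulr_ge0 ?addr_ge0// ltW.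
move=> x y x1 xy; set W := Num.max _ _.
have x0 : 0 < x by exact: lt_le_trans x1.
have W0 : 0 <= W by rewrite le_max powR_ge0.
(* H = (t^b)' u - t^b u', hence H' = t^b u + k t^(b-2) u. *)
pose H t := t `^ b * (b / t * bessel_u t - bessel_u' t).
have HW t : x <= t <= y -> `|H t| <= C * (`|b| + 1) * W.
  move=> xty; have /andP[xt ty] := xty.
  have t1 := le_trans x1 xt; have t0 : 0 < t by exact: lt_le_trans t1.
  have [u1 u2] := uC t t1.
  rewrite /H normrM (ger0_norm (powR_ge0 _ _)) mulrC ler_pM ?powR_ge0 ?powR_le_max//.
  rewrite (le_trans (ler_normB _ _))// mulrDr mulr1 lerD// 2!normrM mulrC ler_pM//.
  by rewrite ler_piMr// normfV ger0_norm ?(ltW t0)// invf_le1.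
pose G t := H t - P t.
have Gxy : `|G y - G x| <= - (`|k| * C * W) / y - - (`|k| * C * W) / x.
  apply: (@is_derive_norm_le _ G (fun t => - (`|k| * C * W) / t)
    (fun t => k * (t `^ b / t ^+ 2) * bessel_u t)
    (fun t => `|k| * C * W / t ^+ 2)) => // t /andP[xt ty].
  - have t1 := le_trans x1 xt; have t0 : 0 < t by exact: lt_le_trans t1.
    have h := is_derive1_powR b t0.
    have hu := is_derive_bessel_u t0.
    have hu' := is_derive_bessel_u' t0.
    have hV := is_derive_invr t0.
    have hP := dP t t1.
    apply: is_derive_eq; rewrite /k /f bessel_kernelE// -/b powR_pred// /GRing.scale/=.
    by field; rewrite gt_eqF.
  - have t1 := le_trans x1 xt; have t0 : 0 < t by exact: lt_le_trans t1.
    have hV := is_derive_invr t0.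
    by apply: is_derive_eq; rewrite /GRing.scale/=; field; rewrite gt_eqF.
  - have t1 := le_trans x1 xt; have t0 : 0 < t by exact: lt_le_trans t1.
    have t2 : 0 < t ^+ 2 by rewrite exprn_gt0.
    have [u1 _] := uC t t1.
    have -> : `|k * (t `^ b / t ^+ 2) * bessel_u t| =
        `|k| * (`|bessel_u t| * t `^ b) / t ^+ 2.
      by rewrite !normrM normfV (gtr0_norm t2) (ger0_norm (powR_ge0 _ _)); ring.
    rewrite ler_pM2r ?invr_gt0// -mulrA ler_wpM2l// ler_pM ?powR_ge0// powR_le_max//.
    by rewrite xt.
have -> : P y - P x = H y - H x - (G y - G x) by rewrite /G; ring.
rewrite (le_trans (ler_normB _ _))// mulrDl lerD//.
  rewrite (le_trans (ler_normB _ _))// -mulrA [leRHS]mulr_natl mulr2n lerD// HW// ?lexx ?xy//.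
rewrite (le_trans Gxy)// mulNr mulNr opprK addrC.
have kCW : 0 <= `|k| * C * W by rewrite !mulr_ge0// ltW.
rewrite (@le_trans _ _ (`|k| * C * W / x))//.
  by rewrite gerBl divr_ge0// (le_trans (ltW x0)).
by rewrite ler_piMr// invf_le1.
Qed.

End bessel_asymptotics.

(** * The kernel t^nu j(rt), with constants independent of r *)

Section scaled_kernel.
Context {R : realType}.
Variable a : R.
Hypothesis a_ge : - (1 / 2) <= a.
Implicit Types x y t nu g r A N : R.

(** Mean value inequality. One power of x is enough: the factor rt it brings is matched with the
    decay of t^(nu+1) f(t). *)
Lemma bessel_e_sub1 : exists2 C, 0 < C &
  forall x, 0 <= x <= 1 -> `|bessel_e a x - 1| <= C * x.
Proof.
have ce x : {for x, continuous (bessel_e' a)}.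
  have h := is_derive_sqr_quarter x.
  have := @is_derive1_comp _ (bessel_p a 1) (fun x => x ^+ 2 / 4) x _ _
    (is_derive_bessel_p a_ge 1 _) h.
  move=> /is_derive_continuous h1; apply: continuousM => //.
  by apply: continuousM; [exact: cvg_id|exact: cst_continuous].
have [C C0 Ce] := @continuous_itv_bounded _ _ 0 1 (fun x _ => ce x).
exists C => // x /andP[x0 x1].
have e0 : bessel_e a 0 = 1 by rewrite /bessel_e expr0n/= mul0r bessel_p0.
rewrite -e0 (_ : C * x = C * x - C * 0); last by rewrite mulr0 subr0.
apply: (@is_derive_norm_le _ (bessel_e a) (fun t => C * t) (bessel_e' a) (cst C)) => //.
- by move=> t _; exact: is_derive_bessel_e.
- by move=> t _; apply: is_derive_eq; rewrite /GRing.scale/= mulr1.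
- by move=> t /andP[t0 tx]; apply: Ce; rewrite t0 (le_trans tx).
Qed.

Lemma scaled_kernel_continuous nu r t : 0 < t ->
  {for t, continuous (fun t => t `^ nu * bessel_e a (r * t))}.
Proof.
move=> t0; apply: continuousM; first exact: continuous_powRl.
have h : is_derive t (1 : R) ( *%R r) r.
  by apply: is_derive_eq; rewrite /GRing.scale/= mulr1.
exact: is_derive_continuous (@is_derive1_comp _ (bessel_e a) _ t _ _
  (is_derive_bessel_e a_ge _) h).
Qed.

(** The substitution s = rt turns a primitive P of the unscaled kernel into r^(-nu-1) P(rt), so one
    K serves all r. *)
Lemma scaled_kernel_antiderivative nu : exists2 K, 0 <= K &
  forall r, 0 < r -> exists2 P : R -> R,
    forall t, 1 <= r * t -> is_derive t (1 : R) P (t `^ nu * bessel_e a (r * t)) &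
    forall x y, 1 <= r * x -> x <= y -> `|P y - P x| <= K * r `^ (- nu - 1) *
      Num.max ((r * x) `^ (nu - a - 1 / 2)) ((r * y) `^ (nu - a - 1 / 2)).
Proof.
have [P [K [K0 dP PK]]] := bessel_kernel_antiderivative a_ge nu.
exists K => // r r0; exists (fun t => r `^ (- nu - 1) * P (r * t)).
  move=> t rt; have t0 : 0 < t by rewrite -(pmulr_rgt0 _ r0) (lt_le_trans ltr01).
  have h : is_derive t (1 : R) ( *%R r) r.
    by apply: is_derive_eq; rewrite /GRing.scale/= mulr1.
  have h1 := @is_derive1_comp _ P _ t _ _ (dP _ rt) h.
  apply: is_derive_eq; rewrite /GRing.scale/= powRM ?ltW// powR_pred// powRN.
  by field; rewrite gt_eqF// gt_eqF ?powR_gt0.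
move=> x y rx xy; rewrite -mulrBr normrM ger0_norm ?powR_ge0//.
rewrite [K * _]mulrC -mulrA ler_wpM2l ?powR_ge0// PK//.
by rewrite ler_pM2l.
Qed.

(* The two admissible exponents are those of the two tail conditions; for the
   second one the primitive is normalised at [A] or at [N] according to the
   sign of [nu - a - 1 / 2]. *)
Lemma scaled_kernel_primitive nu g :
  (nu <= a + 1 / 2 /\ g = nu + 1) \/ g = a + 3 / 2 ->
  exists2 K, 0 <= K & forall r, 0 < r -> forall A N, 1 <= r * A -> A <= N ->
    exists2 P : R -> R,
      forall t, A <= t -> is_derive t (1 : R) P (t `^ nu * bessel_e a (r * t)) &
      forall t, A <= t <= N -> `|P t| <= K * r `^ (- g) * t `^ (nu + 1 - g).
Proof.
move=> gE; have [K K0 KP] := scaled_kernel_antiderivative nu.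
exists K => // r r0 A N rA AN; have [P dP PK] := KP r r0.
have A0 : 0 < A by rewrite -(pmulr_rgt0 _ r0) (lt_le_trans ltr01).
have rle t : A <= t -> 1 <= r * t by move=> At; rewrite (le_trans rA)// ler_pM2l.
have shift c : (forall t, A <= t <= N -> `|P t - c| <= K * r `^ (- g) * t `^ (nu + 1 - g)) ->
    exists2 P : R -> R,
      forall t, A <= t -> is_derive t (1 : R) P (t `^ nu * bessel_e a (r * t)) &
      forall t, A <= t <= N -> `|P t| <= K * r `^ (- g) * t `^ (nu + 1 - g).
  move=> Pc; exists (fun t => P t - c) => // t At.
  by have h := dP _ (rle _ At); apply: is_derive_eq; rewrite subr0.
pose b := nu - a - 1 / 2.
(* The powers of r collect to b - nu - 1 = -(a + 3/2), and b = nu + 1 - (a + 3/2). *)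
have rb t : 0 < t -> K * r `^ (- nu - 1) * (r * t) `^ b =
    K * r `^ (- (a + 3 / 2)) * t `^ (nu + 1 - (a + 3 / 2)).
  move=> t0; rewrite powRM ?ltW// mulrA -[K * _ * _]mulrA -powRD; last first.
    by apply/implyP => _; rewrite gt_eqF.
  by congr (_ * _ `^ _ * _ `^ _); rewrite /b; field.
case: gE => [[nua gE]|gE].
  apply: (@shift (P A)) => t /andP[At tN]; rewrite gE.
  rewrite (le_trans (PK _ _ rA At))// subrr powRr0 mulr1 opprD.
  rewrite -[leRHS]mulr1 ler_wpM2l ?mulr_ge0 ?powR_ge0//.
  have bN : nu - a - 1 / 2 <= 0 by lra.
  have le1 u : 1 <= u -> u `^ (nu - a - 1 / 2) <= 1.
    by move=> u1; have := nonincreasing_powR bN ltr01 u1; rewrite powR1.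
  by rewrite ge_max !le1// rle.
have [b0|/ltW b0] := leP b 0.
  apply: (@shift (P N)) => t /andP[At tN]; rewrite gE.
  have t0 := lt_le_trans A0 At.
  rewrite distrC (le_trans (PK _ _ (rle _ At) tN))// -rb//.
  rewrite ler_wpM2l ?mulr_ge0 ?powR_ge0// ge_max lexx/=.
  by rewrite nonincreasing_powR ?mulr_gt0// ler_pM2l.
apply: (@shift (P A)) => t /andP[At tN]; rewrite gE.
have t0 := lt_le_trans A0 At.
rewrite (le_trans (PK _ _ rA At))// -rb//.
rewrite ler_wpM2l ?mulr_ge0 ?powR_ge0// ge_max lexx andbT.
by apply: ge0_ler_powR; rewrite ?nnegrE ?mulr_ge0 ?(ltW r0) ?(ltW A0) ?(ltW t0)// ler_pM2l.
Qed.

End scaled_kernel.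

(** * Integration by parts with Stieltjes sums *)

Section stieltjes_bound.
Context {R : realType}.
Notation mu := (@lebesgue_measure R).
Implicit Types (f g P V w : R -> R) (t : nat -> R) (x y A N : R).

Lemma integrable_subitv f a b x y : a <= x -> y <= b ->
  mu.-integrable `[a, b] (EFin \o f) -> mu.-integrable `[x, y] (EFin \o f).
Proof.
move=> ax yb; apply: integrableS => //; try exact: measurable_itv.
by apply: subset_itv; rewrite bnd_simp.
Qed.

Lemma Rintegral_split f a b c : a <= b -> b <= c ->
  mu.-integrable `[a, c] (EFin \o f) ->
  \int[mu]_(x in `[a, c]) f x =
  \int[mu]_(x in `[a, b]) f x + \int[mu]_(x in `[b, c]) f x.
Proof.
move=> ab bc fi; apply/eqP; rewrite addrC -subr_eq; apply/eqP.
rewrite Rintegral_itvB// ?bnd_simp// Rintegral_itv_obnd_cbnd//.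
apply: integrableS fi; try exact: measurable_itv.
by apply: subset_itv; rewrite bnd_simp.
Qed.

Lemma Rintegral_partition f t n : {homo t : i j / (i <= j)%N >-> i <= j} ->
  mu.-integrable `[t 0, t n] (EFin \o f) ->
  \int[mu]_(x in `[t 0, t n]) f x =
  \sum_(0 <= i < n) \int[mu]_(x in `[t i, t i.+1]) f x.
Proof.
move=> tm; elim: n => [|n IH] fi; first by rewrite set_itv1 Rintegral_set1 big_nil.
rewrite (@Rintegral_split _ _ (t n)) ?tm// big_nat_recr//= IH//.
by apply: integrable_subitv fi; rewrite ?tm.
Qed.

Lemma abel_summation (u p : nat -> R) n :
  \sum_(0 <= i < n) u i.+1 * (p i.+1 - p i) =
  u n * p n - u 0 * p 0 - \sum_(0 <= i < n) (u i.+1 - u i) * p i.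
Proof.
elim: n => [|n IH]; first by rewrite !big_nil; ring.
by rewrite !big_nat_recr//= IH; ring.
Qed.

(** On one cell [g], possibly discontinuous, is frozen at the right end point; the error is at most
    the increment of [V] times a bound of [f] times the length. *)
Lemma Rintegral_piece_bound f g P V B x y : x <= y ->
  (forall s, x <= s <= y -> {for s, continuous f}) ->
  (forall s, x <= s <= y -> is_derive s (1 : R) P (f s)) ->
  (forall s, x <= s <= y -> `|f s| <= B) ->
  mu.-integrable `[x, y] (EFin \o g) ->
  mu.-integrable `[x, y] (EFin \o (fun s => g s * f s)) ->
  (forall s s', x <= s -> s <= s' -> s' <= y -> `|g s' - g s| <= V s' - V s) ->
  `|\int[mu]_(s in `[x, y]) (g s * f s) - g y * (P y - P x)| <=
  (V y - V x) * B * (y - x).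
Proof.
move=> xy cf dP fB gi gfi gV.
have fi := integrable_continuous cf.
have mxy : measurable (`[x, y] : set R) by exact: measurable_itv.
have gyi : mu.-integrable `[x, y] (EFin \o (fun s => g y * f s)).
  exact: (integrableZl _ (g y) fi).
rewrite -(Rintegral_derive xy cf dP) -RintegralZl// -RintegralB//.
have di : mu.-integrable `[x, y] (EFin \o (fun s => g s * f s - g y * f s)).
  exact: (integrableB _ gfi gyi).
rewrite (le_trans (le_normr_Rintegral _ di))//.
have mE : fine (mu `[x, y]) = y - x.
  rewrite lebesgue_measure_itv/=; move: xy; rewrite le_eqVlt => /predU1P[->|xy].
    by rewrite lte_fin ltxx subrr.
  by rewrite lte_fin xy -EFinD.
rewrite -[in leRHS]mE -Rintegral_cst//; apply: le_Rintegral => //.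
- by move/integrable_norm : di.
- apply: (@integrable_continuous _ (cst _)) => s _; exact: cst_continuous.
- move=> s /=; rewrite in_itv/= => /andP[xs sy].
  rewrite -mulrBl normrM distrC ler_pM//; last by rewrite fB ?xs.
  rewrite (le_trans (gV s y _ _ _))// lerD2l lerN2.
  by rewrite -subr_ge0 (le_trans _ (gV x s _ _ _)).
Qed.

Lemma uniform_partition A N n : A < N ->
  let t i := A + i%:R * ((N - A) / n.+1%:R) in
  let s := [seq t i | i <- iota 1 n.+1] in
  [/\ itv_partition A N s, size s = n.+1,
      forall i, (i <= n.+1)%N -> nth N (A :: s) i = t i &
      {homo t : i j / (i <= j)%N >-> i <= j}].
Proof.
move=> AN t s; have t0 : t 0 = A by rewrite /t mul0r addr0.
have h0 : 0 < (N - A) / n.+1%:R by rewrite divr_gt0// subr_gt0.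
have As : A :: s = [seq t i | i <- iota 0 n.+2] by rewrite /= t0.
have tn : t n.+1 = N by rewrite /t mulrC divfK// addrC subrK.
split.
- split.
    have : sorted <%R [seq t i | i <- iota 0 n.+2].
      apply: (@homo_sorted _ _ t ltn); last exact: iota_ltn_sorted.
      move=> i j ij.
      by rewrite ltrD2l ltr_pM2r// ltr_nat.
    by rewrite -As.
  rewrite -[X in last X]t0 last_map -[iota 1 n.+1]/(behead (iota 0 n.+2)).
  by rewrite (last_nth 0) size_behead size_iota -[0%N :: _]/(iota 0 n.+2) nth_iota//= tn.
- by rewrite size_map size_iota.
- by move=> i ni; rewrite As (nth_map 0)%N ?size_iota ?ltnS// nth_iota ?ltnS.
- by move=> i j ij; rewrite lerD2l ler_pM2r// ler_nat.
Qed.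

(** After freezing [g] on each cell, Abel summation moves the differences from P to g. The resulting
    sum of (g(t_(i+1)) - g(t_i)) P(t_i) is dominated by K times the Stieltjes sum of [w] against [V]
    tagged at left end points, hence by K J up to a small error. *)
Lemma stieltjes_bound f g P V w A N K J : A < N -> 0 <= K ->
  (forall s, A <= s <= N -> {for s, continuous f}) ->
  (forall s, A <= s <= N -> is_derive s (1 : R) P (f s)) ->
  mu.-integrable `[A, N] (EFin \o g) ->
  mu.-integrable `[A, N] (EFin \o (fun s => g s * f s)) ->
  (forall s s', A <= s -> s <= s' -> s' <= N -> `|g s' - g s| <= V s' - V s) ->
  (forall s, A <= s <= N -> `|P s| <= K * w s) ->
  is_stieltjes w V A N J ->
  `|\int[mu]_(s in `[A, N]) (g s * f s)| <=
  K * (`|g N| * w N + `|g A| * w A + J).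
Proof.
move=> AN K0 cf dP gi gfi gV PK wJ.
apply/ler_addgt0Pr => e e0.
have [B B0 fB] := continuous_itv_bounded cf.
have VAN : 0 <= V N - V A by rewrite (le_trans _ (gV A N _ _ _))// ltW.
(* The Stieltjes error is later multiplied by K; K + 1 keeps the denominator positive when K = 0. *)
have e1 : 0 < e / (2 * (K + 1)) by rewrite divr_gt0// mulr_gt0// ltr_wpDl.
have [d d0 dJ] := wJ _ e1.
(* The first summand makes the mesh smaller than d, the second makes the total freezing error at
   most e / 2. *)
pose m := Num.trunc ((N - A) / d + (V N - V A) * B * (N - A) * 2 / e).
pose t i := A + i%:R * ((N - A) / m.+1%:R).
have [sp ss sn tm] := uniform_partition m AN; rewrite -/t in sp ss sn tm.
set s := [seq t i | i <- iota 1 m.+1] in sp ss sn.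
have NA0 : 0 < N - A by rewrite subr_gt0.
have t0 : t 0 = A by rewrite /t mul0r addr0.
have tN : t m.+1 = N by rewrite /t mulrC divfK// addrC subrK.
have tS i : t i.+1 - t i = (N - A) / m.+1%:R by rewrite /t -natr1; ring.
have X0 : 0 <= (V N - V A) * B * (N - A) * 2 / e.
  by rewrite divr_ge0 ?mulr_ge0// ltW.
have hm : (N - A) / d + (V N - V A) * B * (N - A) * 2 / e < m.+1%:R by exact: truncnS_gt.
have hd : (N - A) / m.+1%:R < d.
  rewrite ltr_pdivrMr// mulrC -ltr_pdivrMr//; apply: le_lt_trans hm.
  by rewrite lerDl.
have he : (V N - V A) * B * ((N - A) / m.+1%:R) <= e / 2.
  have : (V N - V A) * B * (N - A) * 2 / e < m.+1%:R.
    by apply: le_lt_trans hm; rewrite lerDr divr_ge0// ltW.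
  by rewrite mulrA ler_pdivrMr// ltr_pdivrMr//; lra.
have tA i : A <= t i by rewrite -t0 tm.
have tNle i : (i <= m.+1)%N -> t i <= N by move=> im; rewrite -tN tm.
have {dJ}dJ : \sum_(0 <= i < m.+1) w (t i) * (V (t i.+1) - V (t i)) <= J + e / (2 * (K + 1)).
  have := dJ s t sp; rewrite /mesh_lt /tagging /stieltjes_sum ss.
  rewrite (@eq_big_nat _ _ _ _ _ _ (fun i => w (t i) * (V (t i.+1) - V (t i)))); last first.
    by move=> i /andP[_ im]; rewrite !sn// ltnW.
  move=> h; have : `|\sum_(0 <= i < m.+1) w (t i) * (V (t i.+1) - V (t i)) - J| <
      e / (2 * (K + 1)).
    apply: h => i im; first by rewrite !sn ?tS// ltnW.
    by rewrite !sn ?lexx ?tm// ltnW.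
  by rewrite ltr_distl => /andP[_ /ltW].
have -> : \int[mu]_(s in `[A, N]) (g s * f s) =
    \sum_(0 <= i < m.+1) \int[mu]_(s in `[t i, t i.+1]) (g s * f s).
  by rewrite -(Rintegral_partition tm) t0 tN.
pose D := \sum_(0 <= i < m.+1) (\int[mu]_(s in `[t i, t i.+1]) (g s * f s) -
  g (t i.+1) * (P (t i.+1) - P (t i))).
have -> : \sum_(0 <= i < m.+1) \int[mu]_(s in `[t i, t i.+1]) (g s * f s) =
    D + \sum_(0 <= i < m.+1) g (t i.+1) * (P (t i.+1) - P (t i)).
  by rewrite /D sumrB subrK.
have Dle : `|D| <= e / 2.
  apply: le_trans he; rewrite (le_trans (ler_norm_sum _ _ _))//.
  rewrite (_ : V N - V A = \sum_(0 <= i < m.+1) (V (t i.+1) - V (t i))); last first.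
    by rewrite telescope_sumr// t0 tN.
  rewrite !mulr_suml; apply: ler_sum_nat => i /andP[_ im]; rewrite -(tS i).
  have sub z : t i <= z <= t i.+1 -> A <= z <= N.
    by move=> /andP[iz zi]; rewrite (le_trans (tA i) iz) (le_trans zi)// tNle.
  apply: Rintegral_piece_bound; first exact: tm.
  - by move=> z /sub; exact: cf.
  - by move=> z /sub; exact: dP.
  - by move=> z /sub; exact: fB.
  - by apply: integrable_subitv gi; rewrite ?tA ?tNle.
  - by apply: integrable_subitv gfi; rewrite ?tA ?tNle.
  - move=> z z' iz zz' zi; apply: gV => //; first exact: le_trans (tA i) iz.
    by rewrite (le_trans zi)// tNle.
rewrite (abel_summation (g \o t) (P \o t))/= t0 tN.
have PN : `|g N * P N| <= `|g N| * (K * w N).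
  by rewrite normrM ler_wpM2l// PK// lexx ltW.
have PA : `|g A * P A| <= `|g A| * (K * w A).
  by rewrite normrM ler_wpM2l// PK// lexx ltW.
have PS : `|\sum_(0 <= i < m.+1) (g (t i.+1) - g (t i)) * P (t i)| <=
    K * (J + e / (2 * (K + 1))).
  rewrite (le_trans (ler_norm_sum _ _ _))// (le_trans _ (ler_wpM2l K0 dJ))//.
  rewrite mulr_sumr; apply: ler_sum_nat => i /andP[_ im].
  rewrite normrM mulrA [leLHS]mulrC ler_pM//.
    by rewrite PK// tA tNle// ltnW.
  by rewrite gV ?tA ?tm ?tNle.
have Ke : K * (e / (2 * (K + 1))) <= e / 2.
  rewrite mulrA ler_pdivrMr ?mulr_gt0 ?ltr_wpDl//; nra.
rewrite (le_trans (ler_normD _ _))// [leRHS]addrC.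
have -> : e + K * (`|g N| * w N + `|g A| * w A + J) =
  e / 2 + (`|g N| * (K * w N) + `|g A| * (K * w A) + (K * J + e / 2)) by field.
rewrite lerD// (le_trans (ler_normB _ _))// lerD//.
  by rewrite (le_trans (ler_normB _ _))// lerD.
by rewrite (le_trans PS)// mulrDr lerD2l.
Qed.

End stieltjes_bound.

(** * Variation of a complex function *)

Section complex_norm.
Context {R : realType}.
Implicit Types z w : R[i].

Lemma normc_ge0 z : 0 <= normc z.
Proof. by case: z => x y; rewrite /= sqrtr_ge0. Qed.

Lemma normr_normc z : `|z| = (normc z)%:C%C.
Proof. by case: z. Qed.

Lemma normr_Re_le z : `|complex.Re z| <= normc z.
Proof. by case: z => x y /=; rewrite -sqrtr_sqr ler_wsqrtr// lerDl sqr_ge0. Qed.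

Lemma normr_Im_le z : `|complex.Im z| <= normc z.
Proof. by case: z => x y /=; rewrite -sqrtr_sqr ler_wsqrtr// lerDr sqr_ge0. Qed.

Lemma normr_Re_sub z w : `|complex.Re z - complex.Re w| <= normc (z - w).
Proof.
have -> : complex.Re z - complex.Re w = complex.Re (z - w) by case: z w => ? ? [].
exact: normr_Re_le.
Qed.

Lemma normr_Im_sub z w : `|complex.Im z - complex.Im w| <= normc (z - w).
Proof.
have -> : complex.Im z - complex.Im w = complex.Im (z - w) by case: z w => ? ? [].
exact: normr_Im_le.
Qed.

Lemma normc_le_ReIm z : normc z <= `|complex.Re z| + `|complex.Im z|.
Proof.
case: z => x y /=; rewrite -[leRHS]ger0_norm ?addr_ge0// -sqrtr_sqr ler_wsqrtr//.
by rewrite sqrrD !real_normK ?num_real// lerD2r lerDl mulrn_wge0// mulr_ge0.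
Qed.

End complex_norm.

Section variation_increment.
Context {R : realType}.
Variable f : R -> R[i].
Hypothesis f_bv : locally_bounded_variation f.
Implicit Types (M s t : R).

Let V M t := fine (ctotal_variation M t f).

Lemma cvariations_nonempty M t : M <= t -> cvariations M t f !=set0.
Proof.
rewrite le_eqVlt => /predU1P[->|Mt].
  by exists (cvariation t t f [::]), [::] => //; split => //=.
by exists (cvariation M t f [:: t]), [:: t] => //; exact: itv_partition1.
Qed.

Lemma ctotal_variationE M t : 0 < M -> M <= t -> V M t = sup (cvariations M t f).
Proof.
move=> M0 Mt; rewrite /V /ctotal_variation.
by rewrite (ereal_sup_EFin (f_bv M0 Mt) (cvariations_nonempty Mt)).
Qed.

(** Appending t to a partition of [M, s] gives a partition of [M, t] with one more increment; then
    the supremum is taken over the former. *)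
Lemma variation_increment M s t : 0 < M -> M <= s -> s <= t ->
  normc (f t - f s) <= V M t - V M s.
Proof.
move=> M0 Ms; rewrite le_eqVlt => /predU1P[->|st]; first by rewrite !subrr normc0.
have Mt := le_trans Ms (ltW st).
rewrite lerBrDl -lerBrDr !ctotal_variationE//.
apply: ge_sup; first exact: cvariations_nonempty.
move=> _ [p [pp pl] <-]; rewrite lerBrDr; apply: ub_le_sup; first exact: f_bv.
exists (rcons p t).
  by split; rewrite ?last_rcons// rcons_path pp (eqP pl).
rewrite /cvariation size_rcons big_nat_recr//=; congr (_ + normc _).
  apply: eq_big_nat => i /andP[_ ip]; congr (normc (f _ - f _)).
    by rewrite nth_rcons ip; apply: set_nth_default.
  case: i ip => [//|i] ip /=.
  by rewrite nth_rcons (ltnW ip); apply: set_nth_default; exact: ltnW.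
rewrite nth_rcons ltnn eqxx; congr (f _ - f _).
rewrite -rcons_cons nth_rcons/= ltnSn -(eqP pl) (last_nth t); exact.
Qed.

(** Turns a bound on the tail integral into a pointwise one, by bounding the weight below by its
    value at A in left-tagged sums. *)
Lemma stieltjes_ge (w U : R -> R) (A N J : R) : A < N ->
  (forall s, A <= s <= N -> w A <= w s) ->
  (forall s t, A <= s -> s <= t -> t <= N -> U s <= U t) ->
  is_stieltjes w U A N J -> w A * (U N - U A) <= J.
Proof.
move=> AN wA Um wJ; apply/ler_addgt0Pr => e e0; have [d d0 dJ] := wJ e e0.
pose m := Num.trunc ((N - A) / d).
pose t i : R := A + i%:R * ((N - A) / m.+1%:R).
have [sp ss sn tm] := uniform_partition m AN; rewrite -/t in sp ss sn tm.
set s := [seq t i | i <- iota 1 m.+1] in sp ss sn.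
have t0 : t 0 = A by rewrite /t mul0r addr0.
have tN : t m.+1 = N by rewrite /t mulrC divfK// addrC subrK.
have tS i : t i.+1 - t i = (N - A) / m.+1%:R by rewrite /t -natr1; ring.
have hd : (N - A) / m.+1%:R < d.
  by rewrite ltr_pdivrMr// mulrC -ltr_pdivrMr// truncnS_gt.
have tA i : A <= t i by rewrite -t0 tm.
have tNle i : (i <= m.+1)%N -> t i <= N by move=> im; rewrite -tN tm.
have : `|stieltjes_sum w U A N s t - J| < e.
  apply: dJ => // i; rewrite ss => im; first by rewrite !sn ?tS// ltnW.
  by rewrite !sn ?lexx ?tm// ltnW.
rewrite ltr_distl => /andP[_ /ltW]; apply: le_trans.
rewrite -t0 -{1}tN -(telescope_sumr (U \o t))// mulr_sumr /stieltjes_sum ss t0.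
apply: ler_sum_nat => i /andP[_ im]; rewrite !sn// ?(ltnW im)// ler_wpM2r//=.
  by rewrite subr_ge0 Um ?tA ?tm ?tNle.
by rewrite wA// tA tNle// ltnW.
Qed.

(** [U] is the variation counted from A. Its integrals up to N converge to a tail of size at most
    (e/2) A^(-g), so they are eventually below e A^(-g). *)
Lemma tail_stieltjes (w : R -> R) (g : R) :
  variation_tail_littleo f w (fun M => M `^ (- g)) ->
  forall e, 0 < e -> \forall A \near +oo, exists2 U : R -> R,
    forall s t, A <= s -> s <= t -> normc (f t - f s) <= U t - U s &
    \forall N \near +oo, exists2 J, is_stieltjes w U A N J & J <= e * A `^ (- g).
Proof.
move=> [T Ttail To] e e0; have e2 : 0 < e / 2 by rewrite divr_gt0.
near=> A.
have A0 : 0 < A by near: A; exact: nbhs_pinfty_gt.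
have Ag : 0 < A `^ (- g) by exact: powR_gt0.
have [J JS JT] : is_variation_tail f w A (T A) by near: A.
have TA : `|T A| <= e / 2 * `|A `^ (- g)| by near: A; exact: To.
exists (V A); first by move=> s t; exact: variation_increment.
have d0 : 0 < e / 2 * A `^ (- g) by rewrite mulr_gt0.
move/cvgrPdist_le : JT => /(_ _ d0) JT.
near=> N; exists (J N).
  by apply: JS; near: N; exact: nbhs_pinfty_ge.
have : `|T A - J N| <= e / 2 * A `^ (- g) by near: N.
move: TA; rewrite (gtr0_norm Ag) !ler_norml => /andP[_ TA] /andP[TJ _].
by rewrite (splitr e) mulrDl; lra.
Unshelve. all: by end_near. Qed.

(** For d >= 0 the weight is nondecreasing, so A^d |f(A) - f(N)| is at most the tail integral from
    A. Then N is taken so far, depending on A, that f(N) is negligible. *)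
Lemma tail_decay (d g : R) : 0 <= d ->
  f t @[t --> +oo] --> (0 : R[i]^o) ->
  variation_tail_littleo f (fun t => t `^ d) (fun M => M `^ (- g)) ->
  forall e, 0 < e -> \forall A \near +oo, A `^ (d + g) * normc (f A) <= e.
Proof.
move=> d0 f0 tail e e0; have e2 : 0 < e / 2 by rewrite divr_gt0.
have tS := tail_stieltjes tail e2.
near=> A.
have A0 : 0 < A by near: A; exact: nbhs_pinfty_gt.
have Ag : 0 < A `^ (- g) by exact: powR_gt0.
have Ad : 0 < A `^ d by exact: powR_gt0.
have [U fU US] : exists2 U : R -> R,
    forall s t, A <= s -> s <= t -> normc (f t - f s) <= U t - U s &
    \forall N \near +oo, exists2 J, is_stieltjes (fun t => t `^ d) U A N J & J <= e / 2 * A `^ (- g).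
  by near: A.
have h0 : 0 < e / 2 * A `^ (- g) / A `^ d by rewrite divr_gt0// mulr_gt0.
have [N [AN [J JS Je] fN]] : exists N, [/\ A < N,
    exists2 J, is_stieltjes (fun t => t `^ d) U A N J & J <= e / 2 * A `^ (- g) &
    normc (f N) <= e / 2 * A `^ (- g) / A `^ d].
  have hC : (0 : R[i]) < (e / 2 * A `^ (- g) / A `^ d)%:C%C by rewrite ltcR.
  have fN : \forall t \near +oo, `|f t| <= (e / 2 * A `^ (- g) / A `^ d)%:C%C.
    exact: (cvgr0_norm_le (f : R -> R[i]^o) f0 _ hC).
  near (pinfty_nbhs R) => N; exists N; split.
  - by near: N; exact: nbhs_pinfty_gt.
  - by near: N.
  - by rewrite -lecR -normr_normc; near: N.
have Um s t : A <= s -> s <= t -> t <= N -> U s <= U t.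
  by move=> As st _; rewrite -subr_ge0 (le_trans _ (fU s t As st))// normc_ge0.
have dm s : A <= s <= N -> A `^ d <= s `^ d.
  move=> /andP[As _]; apply: ge0_ler_powR => //; rewrite nnegrE ?(ltW A0)//.
  exact: le_trans (ltW A0) As.
have := stieltjes_ge AN dm Um JS => hJ.
have fA : normc (f A) <= normc (f N) + (U N - U A).
  have := le_normcD (f N) (- (f N - f A)).
  rewrite normcN (_ : f N + - (f N - f A) = f A); last by rewrite opprB addrC subrK.
  by move=> h; apply: (le_trans h); rewrite lerD2l; exact: fU (ltW AN).
rewrite powRD; last by apply/implyP => _; rewrite gt_eqF.
rewrite mulrAC -ler_pdivlMr ?powR_gt0// -powRN.
rewrite (le_trans (ler_wpM2l (ltW Ad) fA))// mulrDr (splitr e) mulrDl lerD//.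
  by rewrite mulrC -ler_pdivlMr.
exact: le_trans Je.
Unshelve. all: by end_near. Qed.

End variation_increment.

(** * The tail of the transform *)

Section integrability.
Context {R : realType}.
Notation mu := (@lebesgue_measure R).
Implicit Types (f g h : R -> R).

Lemma integrable_mul_continuous g h (a b : R) :
  mu.-integrable `[a, b] (EFin \o g) ->
  (forall x, a <= x <= b -> {for x, continuous h}) ->
  mu.-integrable `[a, b] (EFin \o (fun t => g t * h t)).
Proof.
move=> gi ch; have [C C0 hC] := continuous_itv_bounded ch.
have mh : measurable_fun `[a, b] h.
  have /measurable_int := integrable_continuous ch.
  by move=> /measurable_EFinP.
apply: (integrableMl _ gi mh); first exact: measurable_itv.
exists C; split; first exact: num_real.
by move=> x Cx y; rewrite /= in_itv/= => /hC /le_trans; apply; exact: ltW.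
Qed.

Lemma locally_integrable_itv g (a b : R) : 0 < a ->
  locally_integrable `]0, +oo[ g -> mu.-integrable `[a, b] (EFin \o g).
Proof.
move=> a0 [mg _ gK].
have sub : `[a, b] `<=` `]0, +oo[.
  move=> t /=; rewrite !in_itv/= andbT => /andP[at_ _]; exact: lt_le_trans at_.
apply/integrableP; split.
  by apply/measurable_EFinP; apply: measurable_funS mg => //; exact: measurable_itv.
exact: gK sub (@segment_compact _ _ _).
Qed.

Lemma locally_integrable_power g (nu x y : R) : 0 < x ->
  locally_integrable `]0, +oo[ g ->
  mu.-integrable `[x, y] (EFin \o (fun t => t `^ nu * g t)).
Proof.
move=> x0 gl.
rewrite (_ : (fun t => t `^ nu * g t) = (fun t => g t * t `^ nu)); last first.
  by apply/funext => t; rewrite mulrC.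
apply: integrable_mul_continuous; first exact: locally_integrable_itv.
by move=> t /andP[xt _]; apply: continuous_powRl; exact: lt_le_trans xt.
Qed.

Lemma integrable_glue f (c N : R) : 0 < c -> c <= N ->
  mu.-integrable `]0, c[ (EFin \o f) -> mu.-integrable `[c, N] (EFin \o f) ->
  mu.-integrable `[0, N] (EFin \o f).
Proof.
move=> c0 cN /integrableP[m1 f1] /integrableP[m2 f2].
have U : `]0, N]%classic = (`]0, c[ `|` `[c, N])%classic :> set R.
  by apply: itv_bndbnd_setU; rewrite bnd_simp.
have mo : measurable_fun `]0, N] (EFin \o f).
  by rewrite U; apply/measurable_funU => //; exact: measurable_itv.
apply/integrableP; split.
  exact/measurable_EFinP/measurable_fun_itv_obnd_cbndP/measurable_EFinP.
rewrite -integral_itv_obnd_cbnd//; last by apply: measurableT_comp.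
rewrite U ge0_integral_setU//=; first exact: lte_add_pinfty.
- rewrite -U; apply/measurable_EFinP; apply: measurableT_comp => //.
  exact/measurable_EFinP.
- apply/disj_setPS => t [/=]; rewrite !in_itv/= => /andP[_ tc] /andP[ct _].
  by rewrite ltNge ct in tc.
Qed.

End integrability.

(** * Tail integrals against the kernel, uniformly in r *)

Section tail_estimate.
Context {R : realType}.
Notation mu := (@lebesgue_measure R).
Variables (a nu g : R) (f : R -> R[i]) (u : R -> R).
Hypothesis a_ge : - (1 / 2) <= a.
Hypothesis gE : (nu <= a + 1 / 2 /\ g = nu + 1) \/ g = a + 3 / 2.
Hypothesis g_ge0 : 0 <= g.
Hypothesis f_tail : forall e : R, 0 < e -> \forall A \near +oo, exists2 U : R -> R,
  forall s t, A <= s -> s <= t -> normc (f t - f s) <= U t - U s &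
  \forall N \near +oo,
    exists2 J, is_stieltjes (fun t => t `^ (nu + 1 - g)) U A N J & J <= e * A `^ (- g).
Hypothesis f_decay : forall e : R, 0 < e ->
  \forall A \near +oo, A `^ (nu + 1) * normc (f A) <= e.
(* [u] stands for the real or the imaginary part of [f]. *)
Hypothesis u_inc : forall s t, `|u t - u s| <= normc (f t - f s).
Hypothesis u_le : forall t, `|u t| <= normc (f t).
Hypothesis u_loc : locally_integrable `]0, +oo[ u.
Hypothesis u_cauchy : forall e : R, 0 < e -> \forall M \near +oo, forall N, M <= N ->
  `|\int[mu]_(t in `[M, N]) (t `^ nu * u t)| <= e.

Let k r t := t `^ nu * bessel_e a (r * t).

Let k_integrable (x y : R) r : 0 < x ->
  mu.-integrable `[x, y] (EFin \o (fun t => u t * k r t)).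
Proof.
move=> x0; apply: integrable_mul_continuous; first exact: locally_integrable_itv.
by move=> t /andP[xt _]; apply: scaled_kernel_continuous => //; exact: lt_le_trans xt.
Qed.

(** For rt <= 1 the difference of the integrands is at most C r t^(nu+1) |u(t)| <= C r e, and the
    interval has length at most 1/r. *)
Let near_part : exists2 C, 0 <= C & forall e M r A : R, 0 < M -> 0 < r -> M <= A ->
  r * A <= 1 -> (forall t, M <= t -> t `^ (nu + 1) * normc (f t) <= e) ->
  `|\int[mu]_(t in `[M, A]) (u t * k r t)| <=
  `|\int[mu]_(t in `[M, A]) (t `^ nu * u t)| + C * e.
Proof.
have [C C0 eC] := bessel_e_sub1 a_ge; exists C; first exact: ltW.
move=> e M r A M0 r0 MA rA fe.
have mMA : measurable (`[M, A] : set R) by exact: measurable_itv.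
have i1 := locally_integrable_power nu A M0 u_loc; have i2 := @k_integrable M A r M0.
have i3 : mu.-integrable `[M, A] (EFin \o (fun t => u t * k r t - t `^ nu * u t)).
  exact: (integrableB _ i2 i1).
have e0 : 0 <= e by rewrite (le_trans _ (fe M _))// mulr_ge0 ?powR_ge0 ?normc_ge0.
rewrite -lerBlDl (le_trans (lerB_dist _ _))// -RintegralB//.
rewrite (le_trans (le_normr_Rintegral _ i3))//.
have mE : fine (mu `[M, A]) = A - M.
  rewrite lebesgue_measure_itv/=; move: MA; rewrite le_eqVlt => /predU1P[->|MA].
    by rewrite lte_fin ltxx subrr.
  by rewrite lte_fin MA -EFinD.
apply: (@le_trans _ _ (\int[mu]_(t in `[M, A]) (C * r * e))).
  apply: le_Rintegral => //.
  - by move/integrable_norm : i3.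
  - apply: (@integrable_continuous _ (cst _)) => s _; exact: cst_continuous.
  move=> t /=; rewrite in_itv/= => /andP[Mt tA].
  have t0 : 0 < t by exact: lt_le_trans Mt.
  have -> : u t * k r t - t `^ nu * u t = t `^ nu * u t * (bessel_e a (r * t) - 1).
    by rewrite /k; ring.
  rewrite 2!normrM (ger0_norm (powR_ge0 _ _)).
  have rt : 0 <= r * t <= 1.
    by rewrite mulr_ge0 ?(ltW r0) ?(ltW t0)//= (le_trans _ rA)// ler_pM2l.
  rewrite (le_trans (ler_wpM2l _ (eC _ rt)))// ?mulr_ge0 ?powR_ge0//.
  rewrite (_ : t `^ nu * `|u t| * (C * (r * t)) = C * r * (t `^ (nu + 1) * `|u t|)); last first.
    by rewrite powRD ?powRr1 ?(ltW t0)//; [ring|apply/implyP => _; rewrite gt_eqF].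
  apply: ler_wpM2l; first by rewrite mulr_ge0 ?(ltW C0) ?(ltW r0).
  by rewrite (le_trans _ (fe t Mt))// ler_wpM2l ?powR_ge0.
rewrite Rintegral_cst// mE.
rewrite (_ : C * r * e * (A - M) = C * e * (r * (A - M))); last by ring.
rewrite -[leRHS]mulr1 ler_wpM2l ?mulr_ge0 ?(ltW C0)// (le_trans _ rA)// ler_pM2l//.
by rewrite gerBl ltW.
Qed.

(** Each boundary term and J is at most e A^(-g), whence the factor 3; the remaining (rA)^(-g) is at
    most 1. *)
Let far_part : exists2 K, 0 <= K & forall e A r N J (U : R -> R), 0 < A -> 0 < r ->
  1 <= r * A -> A < N ->
  (forall s t, A <= s -> s <= t -> normc (f t - f s) <= U t - U s) ->
  is_stieltjes (fun t => t `^ (nu + 1 - g)) U A N J -> J <= e * A `^ (- g) ->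
  (forall t, A <= t -> t `^ (nu + 1) * normc (f t) <= e) ->
  `|\int[mu]_(t in `[A, N]) (u t * k r t)| <= K * e.
Proof.
have [K K0 KP] := scaled_kernel_primitive a_ge gE; exists (3 * K).
  by rewrite mulr_ge0.
move=> e A r N J U A0 r0 rA AN fU UJ Je fe.
have [P dP PK] := KP r r0 A N rA (ltW AN).
have Kr0 : 0 <= K * r `^ (- g) by rewrite mulr_ge0 ?powR_ge0.
have e0 : 0 <= e by rewrite (le_trans _ (fe A _))// mulr_ge0 ?powR_ge0 ?normc_ge0.
have h := @stieltjes_bound R (k r) u P U (fun t => t `^ (nu + 1 - g)) A N
  (K * r `^ (- g)) J AN Kr0.
have {h}h : `|\int[mu]_(t in `[A, N]) (u t * k r t)| <= K * r `^ (- g) *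
    (`|u N| * N `^ (nu + 1 - g) + `|u A| * A `^ (nu + 1 - g) + J).
  apply: h => //.
  - by move=> s /andP[As _]; apply: scaled_kernel_continuous => //; exact: lt_le_trans As.
  - by move=> s /andP[As _]; exact: dP.
  - exact: locally_integrable_itv.
  - exact: k_integrable.
  - by move=> s s' As ss' _; rewrite (le_trans (u_inc _ _))// fU.
apply: (le_trans h).
have ut t : A <= t -> `|u t| * t `^ (nu + 1 - g) <= e * A `^ (- g).
  move=> At; have t0 := lt_le_trans A0 At.
  rewrite powRD; last by apply/implyP => _; rewrite gt_eqF.
  rewrite mulrA [`|_| * _]mulrC ler_pM ?mulr_ge0 ?powR_ge0//.
    by rewrite (le_trans _ (fe t At))// ler_wpM2l ?powR_ge0.
  by rewrite nonincreasing_powR// oppr_le0.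
have rAg : r `^ (- g) * A `^ (- g) <= 1.
  have gN : - g <= 0 by rewrite oppr_le0.
  have := nonincreasing_powR gN ltr01 rA.
  by rewrite powR1 powRM// ltW.
rewrite (@le_trans _ _ (K * r `^ (- g) * (3 * (e * A `^ (- g)))))//.
  rewrite ler_wpM2l// (_ : 3 = 1 + 1 + 1) ?mulrDl ?mul1r; last by ring.
  by rewrite !lerD// ut// ltW.
rewrite (_ : K * r `^ (- g) * (3 * (e * A `^ (- g))) =
  3 * K * e * (r `^ (- g) * A `^ (- g))); last by ring.
by rewrite ler_piMr// !mulr_ge0.
Qed.

(** The order of quantifiers matters: the threshold for M is uniform in r, while the one for N
    depends on r through A = max(M, 1/r). *)
Lemma kernel_tail_estimate : forall e : R, 0 < e -> \forall M \near +oo,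
  forall r, 0 < r -> \forall N \near +oo,
  `|\int[mu]_(t in `[M, N]) (u t * k r t)| <= e.
Proof.
move=> e e0; have [C C0 nearP] := near_part; have [K K0 farP] := far_part.
(* Shares: 1 for the integral at r = 0, C for replacing the kernel by 1, K for the part beyond A. *)
pose h := e / (1 + C + K).
have h0 : 0 < h by rewrite divr_gt0// -addrA ltr_pwDl ?addr_ge0.
have [M1 [_ fM1]] := f_tail h0.
have [M2 [_ fM2]] := f_decay h0.
have [M3 [_ fM3]] := u_cauchy h0.
near=> M => r r0.
have M0 : 0 < M by near: M; apply: nbhs_pinfty_gt; exact: num_real.
have MM1 : M1 < M by near: M; apply: nbhs_pinfty_gt; exact: num_real.
have MM2 : M2 < M by near: M; apply: nbhs_pinfty_gt; exact: num_real.
have MM3 : M3 < M by near: M; apply: nbhs_pinfty_gt; exact: num_real.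
pose A := Num.max M r^-1.
have MA : M <= A by rewrite le_max lexx.
have A0 := lt_le_trans M0 MA.
have rA : 1 <= r * A by rewrite -ler_pdivrMl// mulr1 le_max lexx orbT.
have fe t : M <= t -> t `^ (nu + 1) * normc (f t) <= h.
  by move=> Mt; apply: fM2; exact: lt_le_trans Mt.
have [U fU UJ] := fM1 A (lt_le_trans MM1 MA).
near=> N.
have AN : A < N by near: N; apply: nbhs_pinfty_gt; exact: num_real.
have [J JS Jh] : exists2 J, is_stieltjes (fun t => t `^ (nu + 1 - g)) U A N J &
    J <= h * A `^ (- g) by near: N.
rewrite (@Rintegral_split _ _ _ A)// ?(ltW AN)//; last exact: k_integrable.
have -> : e = (h + C * h) + K * h.
  by rewrite /h; field; rewrite gt_eqF// -addrA ltr_pwDl ?addr_ge0.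
rewrite (le_trans (ler_normD _ _))// lerD//; last first.
  apply: (farP h A r N J U) => // t At; apply: fe; exact: le_trans At.
(* If 1/r <= M the near interval reduces to a point. *)
have [rM|rM] := leP r^-1 M.
  have -> : A = M by apply/max_idPl.
  rewrite set_itv1 Rintegral_set1 normr0; apply: addr_ge0; first exact: ltW.
  by apply: mulr_ge0 => //; exact: ltW.
have AE : A = r^-1 by apply/max_idPr; exact: ltW.
rewrite (le_trans (nearP h M r A _ _ _ _ _))// ?AE ?divff ?gt_eqF//.
by rewrite lerD2r -AE; apply: fM3.
Unshelve. all: by end_near. Qed.

Hypothesis u_L1 : mu.-integrable `]0, 1[ (EFin \o (fun t => t `^ nu * u t)).

Let full_integrable r N : 1 <= N ->
  mu.-integrable `[0, N] (EFin \o (fun t => t `^ nu * u t * bessel_e a (r * t))).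
Proof.
move=> N1; apply: integrable_mul_continuous.
  by apply: (@integrable_glue _ _ 1) => //; exact: locally_integrable_power.
move=> t _.
have h : is_derive t (1 : R) ( *%R r) r.
  by apply: is_derive_eq; rewrite /GRing.scale/= mulr1.
exact: is_derive_continuous (@is_derive1_comp _ (bessel_e a) _ t _ _
  (is_derive_bessel_e a_ge _) h).
Qed.

Let T N r := \int[mu]_(t in `[0, N]) (t `^ nu * u t * bessel_j a (r * t)).

Let T_diff r M N : 0 <= r -> 1 <= M -> M <= N ->
  T N r - T M r = \int[mu]_(t in `[M, N]) (u t * k r t).
Proof.
move=> r0 M1 MN; have M0 := le_trans ler01 M1.
have TE x : T x r = \int[mu]_(t in `[0, x]) (t `^ nu * u t * bessel_e a (r * t)).
  apply: eq_Rintegral => t; rewrite inE/= in_itv/= => /andP[t0 _].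
  by rewrite bessel_jE// mulr_ge0.
rewrite !TE (Rintegral_split M0 MN); last first.
  by apply: full_integrable; exact: le_trans MN.
by rewrite addrC addKr; apply: eq_Rintegral => t _; rewrite /k; ring.
Qed.

Lemma transform_uniform_cauchy : forall e : R, 0 < e -> \forall M \near +oo,
  forall N, M <= N -> forall r, `[0, +oo[%classic r -> `|T N r - T M r| <= e.
Proof.
move=> e e0; have e2 : 0 < e / 2 by rewrite divr_gt0.
have [M1 [_ h1]] := kernel_tail_estimate e2.
have [M2 [_ h2]] := u_cauchy e0.
near=> M => N MN r.
rewrite /= in_itv/= andbT => r0.
have MM1 : M1 < M by near: M; apply: nbhs_pinfty_gt; exact: num_real.
have MM2 : M2 < M by near: M; apply: nbhs_pinfty_gt; exact: num_real.
have M1' : 1 <= M by near: M; apply: nbhs_pinfty_ge; exact: num_real.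
have M0 : 0 < M by exact: lt_le_trans M1'.
rewrite T_diff//; move: r0; rewrite le_eqVlt => /predU1P[<-|r0].
  rewrite (_ : \int[mu]_(t in `[M, N]) (u t * k 0 t) =
    \int[mu]_(t in `[M, N]) (t `^ nu * u t)); first exact: h2.
  apply: eq_Rintegral => t _.
  by rewrite /k mul0r /bessel_e expr0n/= mul0r bessel_p0// mulr1 mulrC.
have hM := h1 M MM1 r r0; have hN := h1 N (lt_le_trans MM1 MN) r r0.
(* A common end point beyond the r-dependent thresholds of the tails from M and from N; their
   difference is the integral over [M, N]. *)
near (pinfty_nbhs R) => N'.
have NN' : N <= N' by near: N'; apply: nbhs_pinfty_ge; exact: num_real.
rewrite (_ : \int[mu]_(t in `[M, N]) (u t * k r t) =
    \int[mu]_(t in `[M, N']) (u t * k r t) -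
    \int[mu]_(t in `[N, N']) (u t * k r t)); last first.
  by rewrite (Rintegral_split MN NN') ?addrK//; exact: k_integrable.
rewrite (splitr e) (le_trans (ler_normB _ _))// lerD//.
  by near: N'.
by near: N'.
Unshelve. all: by end_near. Qed.

End tail_estimate.

(** * Uniform convergence *)

Section uniform_cauchy.
Context {R : realType}.
Notation mu := (@lebesgue_measure R).

Lemma uniform_cauchy_limit (T : R -> R -> R) (E : set R) :
  (forall e, 0 < e -> \forall M \near +oo, forall N, M <= N ->
     forall r, E r -> `|T N r - T M r| <= e) ->
  exists L : R -> R, forall e, 0 < e -> \forall M \near +oo,
    forall r, E r -> `|T M r - L r| <= e.
Proof.
move=> Tc; pose L r := lim (T N r @[N --> +oo]); exists L.
have TL r : E r -> T N r @[N --> +oo] --> L r.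
  move=> Er; apply: cauchy_cvg; apply: cauchy_exP => e e0.
  have e2 : 0 < e / 2 by rewrite divr_gt0.
  have TcM := Tc _ e2; near (pinfty_nbhs R) => M; exists (T M r).
  rewrite /=; near=> N.
  rewrite /ball/= distrC (@le_lt_trans _ _ (e / 2))//.
    have h : forall N, M <= N -> forall r, E r -> `|T N r - T M r| <= e / 2 by near: M.
    by apply: h => //; near: N; exact: nbhs_pinfty_ge.
  by rewrite ltr_pdivrMr// ltr_pMr// ltr1n.
move=> e e0; near=> M => r Er.
have h : forall N, M <= N -> forall r, E r -> `|T N r - T M r| <= e by near: M; exact: Tc.
have cL : `|T N r - T M r| @[N --> +oo] --> `|L r - T M r|.
  by apply: cvg_norm; apply: cvgB; [exact: TL|exact: cvg_cst].
rewrite distrC; apply: (cvgr_to_le cL).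
by near=> N; apply: h => //; near: N; exact: nbhs_pinfty_ge.
Unshelve. all: by end_near. Qed.

Lemma cauchy_near (u : R -> R) : cvg (u N @[N --> +oo]) ->
  forall e, 0 < e -> \forall M \near +oo, forall N, M <= N -> `|u N - u M| <= e.
Proof.
move=> uc e e0; have e2 : 0 < e / 2 by rewrite divr_gt0.
have /cvgrPdist_le/(_ _ e2) [M0 [M0r h]] := uc.
exists M0; split=> // M MM0 N MN.
rewrite (splitr e) (_ : u N - u M = (lim (u N @[N --> +oo]) - u M) -
  (lim (u N @[N --> +oo]) - u N)); last by ring.
rewrite (le_trans (ler_normB _ _))// lerD// h//.
exact: lt_le_trans MN.
Qed.

End uniform_cauchy.

Section complex_cvg.
Context {R : realType}.

Lemma cvg_ReIm (F : R -> R[i]^o) (l : R[i]^o) : F N @[N --> +oo] --> l ->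
  (complex.Re (F N) @[N --> +oo] --> complex.Re l) /\
  (complex.Im (F N) @[N --> +oo] --> complex.Im l).
Proof.
move=> Fl; split; apply/cvgrPdist_le => e e0.
- have eC : (0 : R[i]) < e%:C%C by rewrite ltcR.
  have h : \forall N \near +oo, `|l - F N| <= e%:C%C by exact: (cvgr_dist_le (F : R -> R[i]^o) l Fl _ eC).
  apply: filterS h => N; rewrite normr_normc lecR.
  exact/le_trans/normr_Re_sub.
- have eC : (0 : R[i]) < e%:C%C by rewrite ltcR.
  have h : \forall N \near +oo, `|l - F N| <= e%:C%C by exact: (cvgr_dist_le (F : R -> R[i]^o) l Fl _ eC).
  apply: filterS h => N; rewrite normr_normc lecR.
  exact/le_trans/normr_Im_sub.
Qed.

(** Radii in [R[i]^o] are complex; a positive one has zero imaginary part, so real radii suffice. *)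
Lemma uniform_cvgP (T : R -> R -> R[i]^o) (E : set R) (L : R -> R[i]^o) :
  {uniform E, T N @[N --> +oo] --> L} <->
  (forall e : R, 0 < e -> \forall N \near +oo, forall r, E r -> normc (L r - T N r) < e).
Proof.
rewrite restricted_cvgE; split.
- move=> TL e e0; have eC : (0 : R[i]) < e%:C%C by rewrite ltcR.
  have : nbhs (L : {uniform` E -> R[i]^o})
      [set h | forall r, E r -> `|L r - h r| < e%:C%C].
    apply/uniform_nbhs; exists [set xy | ball xy.1 e%:C%C xy.2].
    split; last by move=> h hE r Er; exact: hE.
    exact: (entourage_ball (R[i]^o) (PosNum eC)).
  move=> nL; have h : \forall N \near +oo, forall r, E r -> `|L r - T N r| < e%:C%C.
    exact: TL _ nL.
  by apply: filterS h => N h r /h; rewrite normr_normc ltcR.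
- move=> TL P /uniform_nbhs[B [entB BP]].
  move: entB; rewrite -entourage_ballE => -[e /= e0 eB].
  have er : 0 < complex.Re e by move: e0; case: (e) => x y; rewrite ltcE/= => /andP[].
  have eE : e = (complex.Re e)%:C%C.
    by move: e0; rewrite ltcE/= => /andP[/eqP]; case: (e) => x y /= ->.
  have h := TL _ er; have : \forall N \near +oo, P (T N); last exact.
  apply: filterS h => N h; apply: BP => r Er; apply: eB => /=.
  by rewrite /ball/= normr_normc eE ltcR; exact: h.
Qed.

End complex_cvg.

(** * Real and imaginary parts, and the common form of the tail conditions *)

Section components.
Context {R : realType}.
Notation mu := (@lebesgue_measure R).

Lemma power_cauchy (nu : R) (u : R -> R) :
  locally_integrable `]0, +oo[ u ->
  mu.-integrable `]0, 1[ (EFin \o (fun t => t `^ nu * u t)) ->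
  cvg (\int[mu]_(t in `[0, N]) (t `^ nu * u t) @[N --> +oo]) ->
  forall e : R, 0 < e -> \forall M \near +oo, forall N, M <= N ->
  `|\int[mu]_(t in `[M, N]) (t `^ nu * u t)| <= e.
Proof.
move=> u_loc u_L1 uc e e0.
have h := cauchy_near uc e0.
near=> M => N MN.
have M1 : 1 <= M by near: M; apply: nbhs_pinfty_ge; exact: num_real.
have N1 := le_trans M1 MN.
have i1 : mu.-integrable `[1, N] (EFin \o (fun t => t `^ nu * u t)).
  exact: locally_integrable_power.
have i0 := integrable_glue ltr01 N1 u_L1 i1.
have := Rintegral_split (le_trans ler01 M1) MN i0.
have hM : forall N, M <= N -> `|\int[mu]_(t in `[0, N]) (t `^ nu * u t) -
  \int[mu]_(t in `[0, M]) (t `^ nu * u t)| <= e by near: M.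
by move=> E; have := hM N MN; rewrite E addrC addKr.
Unshelve. all: by end_near. Qed.

Lemma Re_mul_real (x y : R) (z : R[i]) :
  complex.Re (x%:C%C * z * y%:C%C) = x * complex.Re z * y.
Proof. by case: z => p q /=; ring. Qed.

Lemma Im_mul_real (x y : R) (z : R[i]) :
  complex.Im (x%:C%C * z * y%:C%C) = x * complex.Im z * y.
Proof. by case: z => p q /=; ring. Qed.

Lemma Re_mul_reall (x : R) (z : R[i]) : complex.Re (x%:C%C * z) = x * complex.Re z.
Proof. by case: z => p q /=; ring. Qed.

Lemma Im_mul_reall (x : R) (z : R[i]) : complex.Im (x%:C%C * z) = x * complex.Im z.
Proof. by case: z => p q /=; ring. Qed.

Lemma transform_partialE (a nu : R) (f : R -> R[i]) N r :
  transform_partial a nu (- nu) f N r = (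
  (\int[mu]_(t in `[0, N]) (t `^ nu * complex.Re (f t) * bessel_j a (r * t))) +i*
  (\int[mu]_(t in `[0, N]) (t `^ nu * complex.Im (f t) * bessel_j a (r * t))))%C.
Proof.
rewrite /transform_partial addNr powRr0 mul1r /cintegral.
congr Complex; apply: eq_Rintegral => t _; [exact: Re_mul_real|exact: Im_mul_real].
Qed.

Lemma power_partialE (nu : R) (f : R -> R[i]) N :
  power_partial nu f N = (
  (\int[mu]_(t in `[0, N]) (t `^ nu * complex.Re (f t))) +i*
  (\int[mu]_(t in `[0, N]) (t `^ nu * complex.Im (f t))))%C.
Proof.
by congr Complex; apply: eq_Rintegral => t _; [exact: Re_mul_reall|exact: Im_mul_reall].
Qed.

(** At r = 0 the prefactor is 0^0 = 1 and j_a(0) = 1, so the partial integrals coincide exactly;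
    necessity follows by evaluation. *)
Lemma transform_partial0 (a nu : R) (f : R -> R[i]) N :
  transform_partial a nu (- nu) f N 0 = power_partial nu f N.
Proof.
rewrite transform_partialE power_partialE.
by congr Complex; apply: eq_Rintegral => t _; rewrite mul0r /bessel_j eqxx mulr1.
Qed.

(* The exponent [g] is chosen so that both tail conditions read
   [\int_M^oo t^(nu + 1 - g) |df(t)| = o(M^(-g))]. *)
Lemma tail_conditions (a nu : R) (f : R -> R[i]) :
  - (1 / 2) <= a -> locally_bounded_variation f ->
  f t @[t --> +oo] --> (0 : R[i]^o) ->
  (nu < a + 1 / 2 /\ -1 < nu ->
    variation_tail_littleo f (fun=> 1) (fun M => M `^ (- nu - 1))) ->
  (a + 1 / 2 <= nu \/ nu <= -1 ->
    variation_tail_littleo f (fun t => t `^ (nu - a - 1 / 2))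
      (fun M => M `^ (- a - 3 / 2))) ->
  exists g : R, [/\ (nu <= a + 1 / 2 /\ g = nu + 1) \/ g = a + 3 / 2, 0 <= g,
    variation_tail_littleo f (fun t => t `^ (nu + 1 - g)) (fun M => M `^ (- g)) &
    forall e : R, 0 < e -> \forall A \near +oo, A `^ (nu + 1) * normc (f A) <= e].
Proof.
move=> a_ge fbv f0 tail1 tail2.
have [[nua nu1]|h] := pselect (nu < a + 1 / 2 /\ -1 < nu).
  have t1 : variation_tail_littleo f (fun t => t `^ 0) (fun M => M `^ (- (nu + 1))).
    have := tail1 (conj nua nu1); rewrite opprD.
    by congr variation_tail_littleo; apply/funext => t; rewrite powRr0.
  exists (nu + 1); split.
  - by left; split => //; exact: ltW.
  - by rewrite -lerBlDr sub0r ltW.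
  - by rewrite subrr.
  - by have := tail_decay fbv (lexx 0) f0 t1; rewrite add0r.
have h2 : a + 1 / 2 <= nu \/ nu <= -1.
  have [|nua] := leP (a + 1 / 2) nu; first by left.
  by right; rewrite leNgt; apply/negP => nu1; apply: h.
have t2 : variation_tail_littleo f (fun t => t `^ (nu + 1 - (a + 3 / 2)))
    (fun M => M `^ (- (a + 3 / 2))).
  have := tail2 h2; rewrite opprD.
  by congr variation_tail_littleo; apply/funext => t; congr (_ `^ _); field.
exists (a + 3 / 2); split => //; [by right|lra|].
case: h2 => [nua|nu1].
  (* The weight exponent is nu - a - 1/2 >= 0, the sign required by [tail_decay]. *)
  have d0 : 0 <= nu + 1 - (a + 3 / 2) by lra.
  by have := tail_decay fbv d0 f0 t2; rewrite subrK.
(* Here nu + 1 <= 0, so A^(nu+1) <= 1 for A >= 1 and the decay comes from f -> 0. *)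
move=> e e0; have eC : (0 : R[i]) < e%:C%C by rewrite ltcR.
near=> A.
have A1 : 1 <= A by near: A; apply: nbhs_pinfty_ge; exact: num_real.
have fA : normc (f A) <= e.
  rewrite -lecR -normr_normc; near: A.
  exact: (cvgr0_norm_le (f : R -> R[i]^o) f0 _ eC).
apply: le_trans fA; rewrite ler_piMl ?normc_ge0//.
have nu10 : nu + 1 <= 0 by lra.
by have := nonincreasing_powR nu10 ltr01 A1; rewrite powR1.
Unshelve. all: by end_near. Qed.

End components.

Local Open Scope complex_scope.

Theorem theorem4p2 (R : realType) (alpha nu mu : R) (f : R -> R[i])
  (alpha_ge : - (1 / 2) <= alpha)
  (mu_eq : mu = - nu)
  (f_bv : locally_bounded_variation f)
  (f_loc : clocally_integrable `]0, +oo[ f)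
  (f_vanish : f t @[t --> +oo] --> (0 : R[i]^o))
  (f_L1 : cintegrable `]0, 1[ (fun t => (t `^ nu)%:C * f t))
  (tail1 : nu < alpha + 1 / 2 /\ -1 < nu ->
    variation_tail_littleo f (fun=> 1) (fun M => M `^ (- nu - 1)))
  (tail2 : alpha + 1 / 2 <= nu \/ nu <= -1 ->
    variation_tail_littleo f (fun t => t `^ (nu - alpha - 1 / 2))
      (fun M => M `^ (- alpha - 3 / 2))) :
  cvg (power_partial nu f N @[N --> +oo]) <->
  transform_converges_uniformly alpha nu mu f `[0, +oo[.
Proof.
rewrite mu_eq; split=> [pc|[L /uniform_cvgP TL]]; last first.
  apply/cvg_ex; exists (L 0); apply/cvgrPdist_lt => e e0.
  have er : 0 < complex.Re e by move: e0; rewrite ltcE/= => /andP[].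
  have eE : e = (complex.Re e)%:C.
    by move: e0; rewrite ltcE/= => /andP[/eqP]; case: (e) => x y /= ->.
  apply: filterS (TL _ er) => N /(_ 0).
  rewrite transform_partial0 normr_normc eE ltcR; apply.
  by rewrite /= in_itv/= lexx.
have [g [gE g0 tail decay]] := tail_conditions alpha_ge f_bv f_vanish tail1 tail2.
have f_tail := tail_stieltjes f_bv tail.
have [pRe pIm] := cvg_ReIm pc.
have [iRe iIm] := f_L1; have [lRe lIm] := f_loc.
have {}iRe : (@lebesgue_measure R).-integrable `]0, 1[
    (EFin \o (fun t => t `^ nu * complex.Re (f t))).
  by apply: eq_integrable iRe => // t _; rewrite /= Re_mul_reall.
have {}iIm : (@lebesgue_measure R).-integrable `]0, 1[
    (EFin \o (fun t => t `^ nu * complex.Im (f t))).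
  by apply: eq_integrable iIm => // t _; rewrite /= Im_mul_reall.
have cRe : cvg (\int[@lebesgue_measure R]_(t in `[0, N]) (t `^ nu * complex.Re (f t))
    @[N --> +oo]).
  have E N : \int[@lebesgue_measure R]_(t in `[0, N]) (t `^ nu * complex.Re (f t)) =
      complex.Re (power_partial nu f N) by rewrite power_partialE.
  by under eq_fun do rewrite E; exact: (cvgP _ pRe).
have cIm : cvg (\int[@lebesgue_measure R]_(t in `[0, N]) (t `^ nu * complex.Im (f t))
    @[N --> +oo]).
  have E N : \int[@lebesgue_measure R]_(t in `[0, N]) (t `^ nu * complex.Im (f t)) =
      complex.Im (power_partial nu f N) by rewrite power_partialE.
  by under eq_fun do rewrite E; exact: (cvgP _ pIm).
(* The variation and decay bounds stay those of the complex f; only the Cauchy property and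
   integrability are specific to the component. *)
have [LRe hRe] := uniform_cauchy_limit (transform_uniform_cauchy alpha_ge gE g0 f_tail
  decay (fun s t => normr_Re_sub _ _) (fun t => normr_Re_le _)
  lRe (power_cauchy lRe iRe cRe) iRe).
have [LIm hIm] := uniform_cauchy_limit (transform_uniform_cauchy alpha_ge gE g0 f_tail
  decay (fun s t => normr_Im_sub _ _) (fun t => normr_Im_le _)
  lIm (power_cauchy lIm iIm cIm) iIm).
exists (fun r => LRe r +i* LIm r); apply/uniform_cvgP => e e0.
(* Two non-strict bounds by e / 3 give the strict bound by e. *)
have e3 : 0 < e / 3 by rewrite divr_gt0.
near=> N => r Er.
have dRe : forall r, `[0, +oo[%classic r -> `|\int[@lebesgue_measure R]_(t in `[0, N])
  (t `^ nu * complex.Re (f t) * bessel_j alpha (r * t)) - LRe r| <= e / 3.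
  by near: N; exact: hRe.
have dIm : forall r, `[0, +oo[%classic r -> `|\int[@lebesgue_measure R]_(t in `[0, N])
  (t `^ nu * complex.Im (f t) * bessel_j alpha (r * t)) - LIm r| <= e / 3.
  by near: N; exact: hIm.
rewrite transform_partialE (le_lt_trans (normc_le_ReIm _))//=.
rewrite distrC [X in _ + X]distrC (le_lt_trans (lerD (dRe r Er) (dIm r Er)))//.
lra.
Unshelve. all: by end_near. Qed.
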